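(* Let $f$ and $g$ be bounded functions on $\mathbb{R}_+=[0,\infty)$ and consider the linear statistics of the moduli $X(f)=\sum_{k=1}^N f(|z_k|)$ and $X(g)=\sum_{k=1}^N g(|z_k|)$ under $P_N$. Then $$\mathrm{Cov}_N\bigl(X(f),X(g)\bigr)=\sum_{\ell=1}^N\Bigl\{E\Bigl[f\Bigl(\sqrt{\tfrac1N s_\ell}\Bigr)g\Bigl(\sqrt{\tfrac1N s_\ell}\Bigr)\Bigr]-E\Bigl[f\Bigl(\sqrt{\tfrac1N s_\ell}\Bigr)\Bigr]E\Bigl[g\Bigl(\sqrt{\tfrac1N s_\ell}\Bigr)\Bigr]\Bigr\},$$ where $s_\ell=\eta_1+\cdots+\eta_\ell$ for $\{\eta_\ell\}$ a sequence of independent exponential random variables of mean one.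
   Context: Ginibre's complex ensemble: $P_N$ is the probability measure on $\mathbb{C}^N$ given by $$dP_N(z_1,\dots,z_N)=\frac1{Z_N}\prod_{1\le \ell<k\le N}|z_\ell-z_k|^2\,\mu_N(dz_1)\cdots\mu_N(dz_N),\qquad \mu_N(dz)=e^{-N|z|^2}\,d\Re(z)\,d\Im(z),$$ with $Z_N$ the normalizing constant. (It is the joint law of the eigenvalues of an $N\times N$ matrix with independent complex Gaussian entries of mean zero and variance $1/N$.) For linear statistics, $\mathrm{Cov}_N(X(f),X(g))=\int X(f)X(g)\,dP_N-\int X(f)\,dP_N\int X(g)\,dP_N$. Functions are understood to be measurable. *)

(* Defs.v *)
From HB Require Import structures.
From mathcomp Require Import all_boot all_order all_algebra finmap.
From mathcomp Require Import complex.
From mathcomp Require Import all_classical all_reals all_analysis.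
From mathcomp Require Import measurable_realfun.

Set Implicit Arguments.
Unset Strict Implicit.
Unset Printing Implicit Defensive.

Import Order.TTheory GRing.Theory Num.Theory.
Import numFieldNormedType.Exports.
Import ComplexField.Normc.

Local Open Scope classical_set_scope.
Local Open Scope ring_scope.

Section sigma_finite_facts.
Context d (T : measurableType d) (R : realType).
Local Open Scope ereal_scope.

Definition with_sigma_finite (mu : {measure set T -> \bar R})
  (_ : sigma_finite [set: T] mu) : set T -> \bar R := mu.

Section with_sigma_finite.
Variables (mu : {measure set T -> \bar R}) (sf : sigma_finite [set: T] mu).
HB.instance Definition _ := isMeasure.Build _ _ _ (with_sigma_finite sf)
  (measure0 mu) (measure_ge0 mu) (@measure_semi_sigma_additive _ _ _ mu).
HB.instance Definition _ :=
  Measure_isSigmaFinite.Build _ _ _ (with_sigma_finite sf) sf.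
End with_sigma_finite.

Lemma pushforward_sigma_finite d2 (T2 : measurableType d2)
    (m : set T -> \bar R) (f : T -> T2) (g : T2 -> T) :
  sigma_finite [set: T] m -> measurable_fun [set: T2] g -> cancel f g ->
  sigma_finite [set: T2] (pushforward m f).
Proof.
move=> [F TF Foo] mg fgK; exists (fun n => g @^-1` F n) => [|n].
  by rewrite -preimage_bigcup -TF preimage_setT.
have [mF Fn] := Foo n; split; first by rewrite -[X in measurable X]setTI; exact: mg.
by rewrite /pushforward -comp_preimage (_ : g \o f = id)//; apply/funext => x /=.
Qed.

Lemma product_sigma_finite d2 (T2 : measurableType d2)
    (m1 : {sigma_finite_measure set T -> \bar R})
    (m2 : {sigma_finite_measure set T2 -> \bar R}) :
  sigma_finite [set: T * T2] (product_measure1 m1 m2).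
Proof.
have /sigma_finiteP[F [TF ndF Foo]] := sigma_finiteT m1.
have /sigma_finiteP[G [TG ndG Goo]] := sigma_finiteT m2.
exists (fun n => F n `*` G n).
  rewrite -setXTT TF TG predeqE => -[x y]; split.
    move=> [/= [n _ Fnx] [k _ Gky]]; exists (maxn n k) => //; split.
    - by move: x Fnx; exact/subsetPset/ndF/leq_maxl.
    - by move: y Gky; exact/subsetPset/ndG/leq_maxr.
  by move=> [n _ []/= ? ?]; split; exists n.
move=> k; have [? ?] := Foo k; have [? ?] := Goo k.
split; first exact: measurableX.
by rewrite product_measure1E// lte_mul_pinfty// ge0_fin_numE.
Qed.

End sigma_finite_facts.

Section density.
Context d (T : measurableType d) (R : realType).
Local Open Scope ereal_scope.

Definition density (m : set T -> \bar R) (h : T -> R) (A : set T) : \bar R :=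
  \int[m]_(x in A) (h x)%:E.

Variables (m : {measure set T -> \bar R}) (h : T -> R).
Hypothesis (mh : measurable_fun [set: T] h) (h0 : forall x, (0 <= h x)%R).

Lemma density_set0 : density m h set0 = 0.
Proof. exact: integral_set0. Qed.

Lemma density_ge0 A : 0 <= density m h A.
Proof. by apply: integral_ge0 => x _; rewrite lee_fin. Qed.

Lemma density_sigma_additive : semi_sigma_additive (density m h).
Proof.
move=> F mF tF mUF; rewrite /density; apply: cvg_toP.
  apply: ereal_nondecreasing_is_cvgn => i j ij.
  apply: lee_sum_nneg_natr => // k _ _; apply: integral_ge0 => /= x Fkx.
  by rewrite lee_fin.
rewrite ge0_integral_bigcup//=.
- by apply/measurable_EFinP; apply: measurable_funTS.
- by move=> x _; rewrite lee_fin.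
Qed.

Lemma density_sigma_finite : (forall x, (h x <= 1)%R) ->
  sigma_finite [set: T] m -> sigma_finite [set: T] (density m h).
Proof.
move=> h1 [F TF Foo]; exists F => // n; have [mF Fn] := Foo n; split => //.
apply: le_lt_trans Fn; rewrite -[leRHS]mul1e -integral_cst//.
apply: ge0_le_integral => //=.
- by move=> x _; rewrite lee_fin.
- by apply/measurable_EFinP; apply: measurable_funTS.
- by move=> x _; rewrite lee_fin.
Qed.

End density.

Section tuple_measure.
Context d (T : measurableType d) (R : realType).
Local Open Scope ereal_scope.

Definition tcons n (p : T * n.-tuple T) : n.+1.-tuple T := [tuple of p.1 :: p.2].

(* The n-fold product measure of m with itself, on T^n; see tuple_measure_box. *)
Fixpoint tuple_measure (m : set T -> \bar R) (n : nat) :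
    set (n.-tuple T) -> \bar R :=
  match n with
  | 0 => dirac [tuple]
  | n'.+1 => pushforward (product_measure1 m (@tuple_measure m n')) (@tcons n')
  end.

Lemma measurable_tcons n : measurable_fun [set: T * n.-tuple T] (@tcons n).
Proof. exact: measurable_cons. Qed.

Variable m : {sigma_finite_measure set T -> \bar R}.

Lemma tuple_measure_pack n :
  {M : {sigma_finite_measure set (n.-tuple T) -> \bar R}
     | M = @tuple_measure m n :> (set (n.-tuple T) -> \bar R)}.
Proof.
elim: n => [|n [M ME]]; first by exists (dirac [tuple]).
pose uncons (t : n.+1.-tuple T) : T * n.-tuple T := (thead t, [tuple of behead t]).
have mun : measurable_fun setT uncons.
  by apply: measurable_fun_pair; [exact: measurable_tnth|exact: measurable_behead].
have cK : cancel (@tcons n) uncons.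
  by move=> [x t]; rewrite /uncons /tcons theadE; congr pair; exact/val_inj.
have sf := pushforward_sigma_finite (product_sigma_finite m M) mun cK.
have [p pE] : {p : {measure set (n.+1.-tuple T) -> \bar R} |
    p = pushforward (product_measure1 m M) (@tcons n) :> (set _ -> \bar R)}.
  by exists (measure_function_pushforward__canonical__measure_function_Measure
    (m \x M) (@measurable_tcons n)).
rewrite -pE in sf.
by exists (with_sigma_finite sf); rewrite /= -ME -pE.
Qed.

Let tm0 n : @tuple_measure m n set0 = 0.
Proof. by have [M <-] := tuple_measure_pack n; exact: measure0. Qed.

Let tm_ge0 n A : 0 <= @tuple_measure m n A.
Proof. by have [M <-] := tuple_measure_pack n; exact: measure_ge0. Qed.

Let tm_sigma_additive n : semi_sigma_additive (@tuple_measure m n).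
Proof.
by have [M <-] := tuple_measure_pack n; exact: measure_semi_sigma_additive.
Qed.

HB.instance Definition _ n := isMeasure.Build _ _ _
  (@tuple_measure m n) (tm0 n) (@tm_ge0 n) (@tm_sigma_additive n).

Let tm_sigma_finite n : sigma_finite setT (@tuple_measure m n).
Proof. by have [M <-] := tuple_measure_pack n; exact: sigma_finiteT. Qed.

HB.instance Definition _ n := Measure_isSigmaFinite.Build _ _ _
  (@tuple_measure m n) (@tm_sigma_finite n).

Lemma tuple_measure_box n (A : 'I_n -> set T) :
  (forall i, measurable (A i)) ->
  @tuple_measure m n [set t | forall i, A i (tnth t i)] = \prod_(i < n) m (A i).
Proof.
elim: n A => [|n IH] A mA.
  by rewrite big_ord0 /= diracE mem_set// => -[].
rewrite /= /pushforward big_ord_recl -IH//.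
rewrite -[RHS](product_measure1E m (@tuple_measure m n))//.
  congr product_measure1; apply/seteqP; split => [[x t]/= H|[x t]/= [Hx Ht] i].
    split=> [|i]; first by have := H ord0; rewrite tnth0.
    by have := H (lift ord0 i); rewrite tnthS.
  by case: (unliftP ord0 i) => [j|] ->; rewrite ?tnthS ?tnth0.
rewrite (_ : mkset _ = \bigcap_(i in [set: 'I_n])
    ((@tnth _ T ^~ i) @^-1` A (lift ord0 i))).
  apply: fin_bigcap_measurable => // i _; rewrite -[X in measurable X]setTI.
  exact: measurable_tnth.
by apply/seteqP; split => t /= H i; [move=> _|]; exact: H.
Qed.

End tuple_measure.

Section complex_plane.
Context (R : realType).

Definition complex_of_pair (p : R * R) : R[i] := Complex p.1 p.2.
Definition pair_of_complex (z : R[i]) : R * R := (complex.Re z, complex.Im z).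

Lemma complex_of_pairK : cancel complex_of_pair pair_of_complex.
Proof. by case. Qed.

(* The Borel sigma-algebra of C = R^2. *)
Definition complex_measurable : set (set R[i]) :=
  preimage_set_system setT pair_of_complex measurable.

Let sigma_algebra_complex : sigma_algebra setT complex_measurable.
Proof. exact/sigma_algebra_preimage/sigma_algebra_measurable. Qed.

Let complex_measurable0 : complex_measurable set0.
Proof. by case: sigma_algebra_complex. Qed.

Let complex_measurableC A : complex_measurable A -> complex_measurable (~` A).
Proof. by case: sigma_algebra_complex => _ C _ /C; rewrite setTD. Qed.

Let complex_measurable_bigcup (F : (set R[i])^nat) :
  (forall i, complex_measurable (F i)) -> complex_measurable (\bigcup_i F i).
Proof. by case: sigma_algebra_complex => _ _; exact. Qed.

HB.instance Definition _ := isPointed.Build R[i] 0.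
HB.instance Definition _ := @isMeasurable.Build (preimage_display pair_of_complex)
  R[i] complex_measurable complex_measurable0 complex_measurableC
  complex_measurable_bigcup.

Lemma measurable_pair_of_complex : measurable_fun [set: R[i]] pair_of_complex.
Proof. by move=> _ A mA; exists A. Qed.

Lemma measurable_complex_of_pair : measurable_fun [set: R * R] complex_of_pair.
Proof.
move=> _ _ [A mA <-]; rewrite !setTI -comp_preimage.
by rewrite (_ : _ \o _ = id)//; apply/funext; case.
Qed.

(* dRe(z) dIm(z) *)
Definition area : set R[i] -> \bar R :=
  pushforward (product_measure1 lebesgue_measure lebesgue_measure) complex_of_pair.

HB.instance Definition _ := Measure.copy area
  (measure_function_pushforward__canonical__measure_function_Measure
    (product_measure1 lebesgue_measure lebesgue_measure) measurable_complex_of_pair).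

Let area_sigma_finite : sigma_finite setT area.
Proof.
apply: pushforward_sigma_finite measurable_pair_of_complex complex_of_pairK.
exact: (@product_sigma_finite _ _ _ _ _ lebesgue_measure lebesgue_measure).
Qed.

HB.instance Definition _ := Measure_isSigmaFinite.Build _ _ _ area area_sigma_finite.
End complex_plane.

Section ginibre.
Context (R : realType).

Lemma measurable_normc : measurable_fun [set: R[i]] (@normc R).
Proof.
rewrite (_ : @normc R = (fun p : R * R => Num.sqrt (p.1 ^+ 2 + p.2 ^+ 2)) \o
  @pair_of_complex R); last by apply/funext; case.
apply: measurableT_comp; last exact: measurable_pair_of_complex.
apply: measurableT_comp; last first.
  by apply: measurable_funD; apply: measurable_funX.
by apply: continuous_measurable_fun; exact: sqrt_continuous.
Qed.

Lemma measurable_complexB :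
  measurable_fun [set: R[i] * R[i]] (fun p : R[i] * R[i] => p.1 - p.2).
Proof.
rewrite (_ : (fun p => _) = @complex_of_pair R \o
  (fun p : (R * R) * (R * R) => (p.1.1 - p.2.1, p.1.2 - p.2.2)) \o
  (fun p : R[i] * R[i] => (pair_of_complex p.1, pair_of_complex p.2))); last first.
  by apply/funext => -[[a b] [c e]].
apply: measurableT_comp.
  apply: measurableT_comp; first exact: measurable_complex_of_pair.
  apply: measurable_fun_pair; apply: measurable_funB; exact: measurableT_comp.
apply: measurable_fun_pair.
  by apply: measurableT_comp => //; exact: measurable_pair_of_complex.
by apply: measurableT_comp => //; exact: measurable_pair_of_complex.
Qed.

Definition gaussian_density (N : nat) (z : R[i]) : R :=
  expR (- (N%:R * normc z ^+ 2)).

(* e^(-N|z|^2) dRe(z) dIm(z), not normalized (mass pi/N). The modulus is normc,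
   which is R-valued; the norm `|z| of complex.v is R[i]-valued. *)
Definition gaussian_measure (N : nat) : set R[i] -> \bar R :=
  density (@area R) (gaussian_density N).

Let gd_ge0 N z : 0 <= gaussian_density N z.
Proof. exact: expR_ge0. Qed.

Lemma measurable_gaussian_density N :
  measurable_fun [set: R[i]] (gaussian_density N).
Proof.
apply: measurableT_comp => //; apply: measurableT_comp => //.
apply: measurable_funM => //; apply: measurable_funX; exact: measurable_normc.
Qed.

HB.instance Definition _ N := isMeasure.Build _ _ _ (gaussian_measure N)
  (density_set0 (@area R) (gaussian_density N))
  (@density_ge0 _ _ _ (@area R) _ (@gd_ge0 N))
  (@density_sigma_additive _ _ _ (@area R) _ (measurable_gaussian_density N) (@gd_ge0 N)).

Let gaussian_sigma_finite N : sigma_finite setT (gaussian_measure N).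
Proof.
apply: density_sigma_finite; last exact: sigma_finiteT.
- exact: measurable_gaussian_density.
- exact: gd_ge0.
- by move=> z; rewrite -expR0 ler_expR oppr_le0 mulr_ge0// sqr_ge0.
Qed.

HB.instance Definition _ N := Measure_isSigmaFinite.Build _ _ _
  (gaussian_measure N) (@gaussian_sigma_finite N).

Definition vandermonde_sq (N : nat) (z : N.-tuple R[i]) : R :=
  \prod_(l < N) \prod_(k < N | (l < k)%N) normc (tnth z l - tnth z k) ^+ 2.

Definition ginibre_weight (N : nat) : set (N.-tuple R[i]) -> \bar R :=
  density (@tuple_measure _ _ _ (gaussian_measure N) N) (@vandermonde_sq N).

Let vd_ge0 N z : 0 <= @vandermonde_sq N z.
Proof. by do 2!apply: prodr_ge0 => ? _; exact: sqr_ge0. Qed.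

Lemma measurable_vandermonde_sq N :
  measurable_fun [set: N.-tuple R[i]] (@vandermonde_sq N).
Proof.
apply: measurable_prod => l _.
rewrite (_ : (fun z => _) = fun z : N.-tuple R[i] => \prod_(k < N)
  if (l < k)%N then normc (tnth z l - tnth z k) ^+ 2 else 1); last first.
  by apply/funext => z; rewrite big_mkcond.
apply: measurable_prod => k _; case: (l < k)%N => //; apply: measurable_funX.
apply: measurableT_comp; first exact: measurable_normc.
have mB := measurable_complexB.
apply: (@measurableT_comp _ _ _ _ _ _ _ _
  (fun z : N.-tuple R[i] => (tnth z l, tnth z k)) mB).
by apply: measurable_fun_pair; exact: measurable_tnth.
Qed.

HB.instance Definition _ N := isMeasure.Build _ _ _ (@ginibre_weight N)
  (density_set0 (@tuple_measure _ _ _ (gaussian_measure N) N) (@vandermonde_sq N))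
  (@density_ge0 _ _ _ (@tuple_measure _ _ _ (gaussian_measure N) N) _ (@vd_ge0 N))
  (@density_sigma_additive _ _ _ (@tuple_measure _ _ _ (gaussian_measure N) N) _
    (@measurable_vandermonde_sq N) (@vd_ge0 N)).

(* The probability measure P_N; Z_N is the total mass of ginibre_weight. The
   second argument of mnormalize is a default value for the case Z_N = 0 or
   Z_N = +oo, which does not occur: 0 < Z_N < +oo for every N. *)
Definition ginibre (N : nat) : probability (N.-tuple R[i]) R :=
  mnormalize (@ginibre_weight N) (dirac ([tuple of nseq N 0] : N.-tuple R[i])).

Definition moduli_statistic (N : nat) (f : R -> R) (z : N.-tuple R[i]) : R :=
  \sum_(k < N) f (normc (tnth z k)).

End ginibre.

Section probability.
Context d (T : measurableType d) (R : realType) (P : probability T R).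
Local Open Scope ereal_scope.

Definition cov (X Y : T -> R) : \bar R :=
  'E_P[fun w => (X w * Y w)%R] - 'E_P[X] * 'E_P[Y].

Definition mutually_independent (X : nat -> T -> R) : Prop :=
  forall (J : {fset nat}) (A : nat -> set R), (forall i, measurable (A i)) ->
  P (\bigcap_(i in [set` J]) (X i @^-1` A i)) = \prod_(i <- J) P (X i @^-1` A i).

(* Restricted to measurable sets: exponential_prob is an integral, hence
   meaningless as a measure elsewhere. *)
Definition has_law (X : T -> R) (Q : set R -> \bar R) : Prop :=
  forall A, measurable A -> P (X @^-1` A) = Q A.

End probability.

(* X k, k = 0, 1, ..., is the (k+1)-st variable; partial_sum X l has l terms. *)
Definition partial_sum (T : Type) (R : realType) (X : nat -> T -> R) (l : nat)
  (w : T) : R := \sum_(k < l) X k w.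

(* Main.v *)
Require Import Defs.
From HB Require Import structures.
From mathcomp Require Import all_boot all_order all_algebra finmap.
From mathcomp Require Import all_fingroup cyclic separable cyclotomic.
From mathcomp Require Import complex.
From mathcomp Require Import all_classical all_reals all_analysis.
From mathcomp Require Import measurable_realfun.
From mathcomp Require Import ring lra.

Import Order.TTheory GRing.Theory Num.Theory.
Import numFieldNormedType.Exports.

Local Open Scope classical_set_scope.
Local Open Scope ring_scope.

Set Implicit Arguments.
Unset Strict Implicit.
Unset Printing Implicit Defensive.
Import ComplexField.Normc.

(** Under the Ginibre law the unordered family of moduli is distributed like
    the family of independent radii [sqrt (s_l / N)], [1 <= l <= N] (Kostlan).
    For linear statistics this means that the pair of sums has the moments of
    a pair of sums over independent variables, whose covariance is the sum of
    the individual covariances.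

    Write [Delta] for the Vandermonde determinant. The weight [|Delta|^2] is a
    double sum over permutations [s], [t] of the monomials
    [prod_k z_k^(s k) conj(z_k)^(t k)]. Against a product of radial functions
    the terms with [s <> t] integrate to zero, because the Gaussian measure is
    invariant under rotations of each coordinate. Instead of integrating over
    a continuous torus, and instead of complex-valued integrals, the proof
    averages over the finite torus of [N]-th roots of unity: exponents range
    below [N], so the discrete characters are already orthogonal, and the
    averaged weight is pointwise equal to the permanent
    [sum_s prod_k |z_k|^(2 s k)] ([vandermonde_sq_torus_average]). Only
    integrals of non-negative real functions remain, and they factor
    coordinatewise ([ge0_integral_vandermonde_radial]).

    Two facts about the planar area measure replace polar coordinates. It is
    invariant under rotations, since a rotation is a composition of three
    shears, and a shear preserves area by Tonelli and translation invariance
    ([ge0_integral_rotation2]). Its image under [z |-> |z|^2] is a multiple of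
    Lebesgue measure on the half-line, since the area of a disc is
    proportional to the squared radius ([ge0_integral_area_radial]). Hence the
    [j]-th radial Gaussian moment of [phi] is a constant times the integral of
    [phi (sqrt (t / N))] against the Gamma density [t^j e^(-t) / j!]
    ([gaussian_radial_moment]).

    On the other side, the first [n] variables [eta_k] have the [n]-fold product
    of the exponential law as joint law (product sets generate the
    sigma-algebra), and convolving exponentials gives the same Gamma densities
    ([partial_sum_exponential_law]). The constants cancel in the normalized
    measure, and
    [E prod_k phi_k(|z_k|) = (1/N!) sum_s prod_k E phi_k(r_(s k))]
    ([expectation_ginibre_radial_product]). Taking all factors but one or two
    equal to one gives the moments of the linear statistics.

    Working with non-negative integrands requires non-negative [f] and [g];
    bounded functions are reduced to this case by adding constants, under which
    both sides are invariant ([cov_shift]). *)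

(** * The squared Vandermonde determinant averaged over roots of unity *)

Lemma exists_prim_root (C : numClosedFieldType) (n : nat) :
  (0 < n)%N -> {w : C | n.-primitive_root w}.
Proof.
move=> n0; apply/sigW.
have [r Dp] := closed_field_poly_normal ('X^n - 1 : {poly C}).
rewrite (monicP _) ?monicXnsubC// scale1r in Dp.
have rn1 : all n.-unity_root r.
  by apply/allP => z; rewrite -root_prod_XsubC -Dp.
have sz_r : (n < (size r).+1)%N.
  by rewrite -(size_prod_XsubC r id) -Dp size_XnsubC.
have [|z] := hasP (has_prim_root n0 rn1 _ sz_r); last by exists z.
by rewrite -separable_prod_XsubC -Dp separable_Xn_sub_1// pnatr_eq0 -lt0n.
Qed.

Lemma normcX (R : realType) (z : R[i]) n : normc (z ^+ n) = normc z ^+ n.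
Proof. by elim: n => [|n IH]; rewrite ?normc1// !exprS normcM IH. Qed.

Lemma normc_ge0 (R : realType) (z : R[i]) : 0 <= normc z.
Proof. by case: z => a b; exact: sqrtr_ge0. Qed.

(** A non-negative real whose [n]-th power is one equals one. *)
Lemma normc_prim_root (R : realType) (w : R[i]) n :
  n.-primitive_root w -> normc w = 1.
Proof.
move=> pw; have n0 := prim_order_gt0 pw.
have /eqP := congr1 (@normc R) (prim_expr_order pw).
by rewrite normcX normc1 pexpr_eq1// ?normc_ge0// => /eqP.
Qed.

Lemma sqr_normcE (R : realType) (z : R[i]) :
  ((normc z ^+ 2)%:C = z * conjc z)%C.
Proof. by rewrite -sqr_normc rmorphXn/= normc_def; case: z. Qed.

(** Orthogonality of the characters of the cyclic group of order [N]. It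
    separates exponents below [N], the range of exponents in a Vandermonde
    determinant. *)
Lemma prim_root_orthogonality (R : realType) (N : nat) (w : R[i]) (a b : 'I_N) :
  N.-primitive_root w ->
  \sum_(j < N) w ^+ (j * a) * conjc (w ^+ (j * b)) = (N * (a == b))%:R.
Proof.
move=> pw; pose u := w ^+ a * conjc (w ^+ b).
have -> : \sum_(j < N) w ^+ (j * a) * conjc (w ^+ (j * b)) = \sum_(j < N) u ^+ j.
  apply: eq_bigr => j _.
  by rewrite /u exprMn -rmorphXn/= -!exprM mulnC [(b * j)%N]mulnC.
have ww : w ^+ b * conjc (w ^+ b) = 1.
  by rewrite -sqr_normcE normcX (normc_prim_root pw) !expr1n.
have [ab|ab] := eqVneq a b.
  rewrite muln1 (eq_bigr (fun=> 1)) ?sumr_const ?card_ord// => j _.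
  by rewrite /u -ab -sqr_normcE normcX (normc_prim_root pw) !expr1n.
rewrite muln0.
have u1 : u != 1.
  apply: contra ab => /eqP uE; rewrite -val_eqE/=.
  have := eq_prim_root_expr pw a b; rewrite !modn_small// => <-.
  by rewrite -[w ^+ a]mulr1 -ww mulrCA -/u uE mulr1.
have wN : w ^+ N = 1 by exact: prim_expr_order.
apply: (mulfI (_ : u - 1 != 0)); first by rewrite subr_eq0.
rewrite mulr0 -subrX1 /u exprMn -rmorphXn/= -!exprM [(a * N)%N]mulnC [(b * N)%N]mulnC.
by rewrite 2!exprM wN !expr1n rmorph1 mulr1 subrr.
Qed.

(** The transposed Leibniz expansion, so that the permutation gives the exponent
    attached to each variable. *)
Lemma det_Vandermonde_expand (R : comNzRingType) (n : nat) (a : 'rV[R]_n) :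
  \prod_(i < n) \prod_(j < n | (i < j)%N) (a 0 j - a 0 i) =
  \sum_(s : 'S_n) (-1) ^+ s * \prod_(k < n) a 0 k ^+ s k.
Proof.
rewrite -det_Vandermonde -det_tr; apply: eq_bigr => s _; congr (_ * _).
by apply: eq_bigr => k _; rewrite !mxE.
Qed.

Lemma vandermonde_sqE (R : realType) (N : nat) (z : N.-tuple R[i]) :
  ((vandermonde_sq z)%:C)%C =
  \sum_(s : 'S_N) \sum_(t : 'S_N) ((-1) ^+ s * (-1) ^+ t) *
    \prod_(k < N) (tnth z k ^+ s k * conjc (tnth z k ^+ t k)).
Proof.
pose D := \prod_(i < N) \prod_(j < N | (i < j)%N)
  ((\row_k tnth z k) 0 j - (\row_k tnth z k) 0 i : R[i]).
have -> : ((vandermonde_sq z)%:C)%C = D * conjc D.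
  rewrite /vandermonde_sq rmorph_prod /D rmorph_prod/= -big_split/=.
  apply: eq_bigr => i _; rewrite !rmorph_prod/= -big_split/=.
  apply: eq_bigr => j _.
  by rewrite !mxE -[X in normc X]opprB normcN sqr_normcE.
rewrite /D det_Vandermonde_expand rmorph_sum/= mulr_suml; apply: eq_bigr => s _.
rewrite mulr_sumr; apply: eq_bigr => t _.
rewrite rmorphM/= rmorph_sign mulrACA; congr (_ * _).
rewrite rmorph_prod/= -big_split/=.
by apply: eq_bigr => k _; rewrite !mxE.
Qed.


(** The average over the finite torus factors into one character sum per
    coordinate; two distinct permutations differ at some coordinate, and the
    corresponding factor is zero. *)
Lemma torus_average_monomial (R : realType) (N : nat) (w : R[i])
    (z : N.-tuple R[i]) (s t : 'S_N) : N.-primitive_root w ->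
  \sum_(j : {ffun 'I_N -> 'I_N}) \prod_(k < N)
     ((w ^+ j k * tnth z k) ^+ s k * conjc ((w ^+ j k * tnth z k) ^+ t k)) =
  (N ^ N * (s == t))%:R * \prod_(k < N) (tnth z k ^+ s k * conjc (tnth z k ^+ t k)).
Proof.
move=> pw.
rewrite -(bigA_distr_bigA (fun k (i : 'I_N) =>
  (w ^+ i * tnth z k) ^+ s k * conjc ((w ^+ i * tnth z k) ^+ t k)))/=.
under eq_bigr => k _.
  under eq_bigr => i _.
    rewrite !exprMn rmorphM/= -!exprM mulrACA; over.
  rewrite -mulr_suml prim_root_orthogonality//; over.
rewrite big_split/=; congr (_ * _).
have [->|st] := eqVneq s t.
  under eq_bigr do rewrite eqxx muln1.
  by rewrite prodr_const card_ord muln1 natrX.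
have [k sk] : exists k, s k != t k.
  apply/existsP; rewrite -negb_forall; apply: contra st => /forallP H.
  by apply/eqP/permP => k; apply/eqP.
by rewrite (bigD1 k)//= (negbTE sk) !muln0 mul0r.
Qed.

(** The off-diagonal terms of the double expansion vanish on averaging, leaving a
    permanent in the squared moduli, with non-negative terms. *)
Lemma vandermonde_sq_torus_average (R : realType) (N : nat) (w : R[i])
    (z : N.-tuple R[i]) : N.-primitive_root w ->
  \sum_(j : {ffun 'I_N -> 'I_N})
     vandermonde_sq [tuple w ^+ j k * tnth z k | k < N] =
  (N ^ N)%:R * \sum_(s : 'S_N) \prod_(k < N) (normc (tnth z k) ^+ 2) ^+ s k.
Proof.
move=> pw; apply: (@complexI R); rewrite rmorph_sum/=.
under eq_bigr do rewrite vandermonde_sqE.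
rewrite exchange_big/= rmorphM/= rmorph_sum/= mulr_sumr; apply: eq_bigr => s _.
rewrite exchange_big/=.
under eq_bigr => t _.
  rewrite -mulr_sumr.
  under eq_bigr => j _ do under eq_bigr => k _ do rewrite tnth_mktuple.
  rewrite torus_average_monomial//; over.
rewrite (bigD1 s)//= [X in _ + X]big1 ?addr0; last first.
  by move=> t /negbTE ts; rewrite eq_sym ts muln0 mul0r mulr0.
rewrite -signr_addb addbb mul1r eqxx muln1 rmorph_nat; congr (_ * _).
rewrite rmorph_prod; apply: eq_bigr => k _.
by rewrite -sqr_normcE normcX -!exprM mulnC.
Qed.

(** * Non-negative integrals against densities and product measures *)

Section nonnegative_integrals.
Local Open Scope ereal_scope.
Import HBNNSimple.

(** By monotone approximation by simple functions, for which it is linearity.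
    The measure [nu] is given by its values, so that the lemma applies to any
    measure structure carried by those values. *)
Lemma ge0_integral_density d (T : measurableType d) (R : realType)
    (m nu : {measure set T -> \bar R}) (h : T -> R) (F : T -> \bar R) :
  measurable_fun setT h -> (forall x, (0 <= h x)%R) ->
  (forall A, measurable A -> nu A = \int[m]_(x in A) (h x)%:E) ->
  measurable_fun setT F -> (forall x, 0 <= F x) ->
  \int[nu]_x F x = \int[m]_x (F x * (h x)%:E).
Proof.
move=> mh h0 nuE mF F0; pose F_ := nnsfun_approx measurableT mF.
have F_cvg x : EFin (F_ n x) @[n --> \oo] --> F x by exact: cvg_nnsfun_approx.
have F_nd x a b : (a <= b)%N -> (F_ a x <= F_ b x)%R.
  by move=> ab; exact/lefP/nd_nnsfun_approx.
have mhE : measurable_fun setT (EFin \o h) by exact/measurable_EFinP.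
transitivity (limn (fun n => \int[nu]_x (F_ n x)%:E)).
  rewrite -monotone_convergence//.
  - by apply: eq_integral => x _; apply/esym/cvg_lim => //; exact: F_cvg.
  - by move=> n; exact/measurable_EFinP.
  - by move=> n x _; rewrite lee_fin.
  - by move=> x _ a b ab; rewrite lee_fin F_nd.
transitivity (limn (fun n => \int[m]_x ((F_ n x)%:E * (h x)%:E))); last first.
  rewrite -monotone_convergence//.
  - apply: eq_integral => x _; apply/cvg_lim => //; apply: cvgeZr => //.
  - by move=> n; apply: emeasurable_funM => //; exact/measurable_EFinP.
  - by move=> n x _; rewrite mule_ge0// lee_fin.
  - by move=> x _ a b ab; rewrite lee_wpmul2r// lee_fin// F_nd.
congr (limn _); apply/funext => n.
under eq_integral do rewrite fimfunE -fsumEFin//.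
under [RHS]eq_integral => x _.
  rewrite fimfunE -fsumEFin// ge0_mule_fsuml; last first.
    by move=> r; exact: nnfun_muleindic_ge0.
  over.
rewrite !ge0_integral_fsum//=; last 4 first.
- move=> r; apply: emeasurable_funM => //; apply/measurable_EFinP.
  exact: measurable_funM.
- by move=> r x _; rewrite mule_ge0 ?nnfun_muleindic_ge0// lee_fin.
- by move=> r; apply/measurable_EFinP; exact: measurable_funM.
- by move=> r x _; exact: nnfun_muleindic_ge0.
apply: eq_fsbigr => r; rewrite inE => -[x0 _ rE].
have r0 : (0 <= r)%R by rewrite -rE.
rewrite integralZl_indic_nnsfun// integral_indic// setIT nuE//.
under [RHS]eq_integral do rewrite EFinM -muleA.
rewrite ge0_integralZl//.
- under [in RHS]eq_integral do rewrite muleC.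
  rewrite integral_mkcond; congr (_ * _); apply: eq_integral => x _.
  by rewrite epatch_indic.
- by apply: emeasurable_funM => //; exact/measurable_EFinP.
- by move=> x _; rewrite mule_ge0// lee_fin.
Qed.

Section tuple_measure_integral.
Context d (T : measurableType d) (R : realType).
Variable m : {sigma_finite_measure set T -> \bar R}.
Local Notation tm n := (@tuple_measure _ _ _ m n).

Lemma ge0_integral_tuple_measure0 (F : 0.-tuple T -> \bar R) :
  (forall t, 0 <= F t) -> \int[tm 0]_t F t = F [tuple].
Proof.
move=> F0.
rewrite (eq_measure_integral (dirac [tuple] : {measure set (0.-tuple T) -> \bar R}))//.
rewrite integral_dirac ?diracT ?mul1e//.
move=> _ A _; rewrite setTI.
have [A0|A0] := pselect (A (F [tuple])).
  by rewrite (_ : _ @^-1` _ = setT)//; apply/seteqP; split => // t _ /=; rewrite tuple0.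
rewrite (_ : _ @^-1` _ = set0)//; apply/seteqP; split => // t /=.
by rewrite tuple0.
Qed.

Lemma measurable_tcons_section n (x : T) :
  measurable_fun setT (fun t : n.-tuple T => tcons (x, t)).
Proof. exact: (measurableT_comp (@measurable_tcons _ T n) (pair1_measurable x)). Qed.

(** The head coordinate is integrated last; this is the induction step for
    statements about product measures. *)
Lemma ge0_integral_tuple_measureS n (F : n.+1.-tuple T -> \bar R) :
  measurable_fun setT F -> (forall t, 0 <= F t) ->
  \int[tm n.+1]_t F t = \int[m]_x \int[tm n]_t F (tcons (x, t)).
Proof.
move=> mF F0.
have mc := @measurable_tcons _ T n.
pose pf : {measure set (n.+1.-tuple T) -> \bar R} :=
  measure_function_pushforward__canonical__measure_function_Measure
    (m \x tm n)%E mc.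
rewrite (eq_measure_integral pf)//.
rewrite ge0_integral_pushforward// preimage_setT.
rewrite fubini_tonelli1//=; first exact: measurableT_comp.
Qed.

Lemma measurable_tuple_prod n (phi : 'I_n -> T -> R) :
  (forall k, measurable_fun setT (phi k)) ->
  measurable_fun setT (fun t : n.-tuple T => \prod_(k < n) phi k (tnth t k))%R.
Proof.
move=> mphi; apply: measurable_prod => k _.
exact: (measurableT_comp (mphi k) (measurable_tnth k)).
Qed.

Lemma ge0_integral_tuple_measure_prod n (phi : 'I_n -> T -> R) :
  (forall k, measurable_fun setT (phi k)) -> (forall k x, 0 <= phi k x)%R ->
  \int[tm n]_t (\prod_(k < n) phi k (tnth t k))%:E =
  \prod_(k < n) \int[m]_x (phi k x)%:E.
Proof.
elim: n phi => [|n IH] phi mphi phi0.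
  rewrite ge0_integral_tuple_measure0 ?big_ord0// => t.
  by rewrite lee_fin big_ord0.
rewrite ge0_integral_tuple_measureS; last 2 first.
- by apply/measurable_EFinP; exact: measurable_tuple_prod.
- by move=> t; rewrite lee_fin; apply: prodr_ge0.
rewrite big_ord_recl -IH//.
rewrite -ge0_integralZr//; last 3 first.
- exact/measurable_EFinP.
- by move=> x _; rewrite lee_fin.
- by apply: integral_ge0 => t _; rewrite lee_fin; apply: prodr_ge0.
apply: eq_integral => x _.
rewrite -ge0_integralZl//; last 3 first.
- apply/measurable_EFinP; exact: (measurable_tuple_prod (fun k => mphi (lift ord0 k))).
- by move=> t _; rewrite lee_fin; apply: prodr_ge0.
- by rewrite lee_fin.
apply: eq_integral => t _; rewrite big_ord_recl tnth0 -EFinM.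
by under eq_bigr do rewrite tnthS.
Qed.

Lemma measurable_tuple_map n (h : 'I_n -> T -> T) :
  (forall k, measurable_fun setT (h k)) ->
  measurable_fun setT (fun t : n.-tuple T => [tuple h k (tnth t k) | k < n]).
Proof.
move=> mh; apply/measurable_fun_tnthP => i.
rewrite (_ : _ \o _ = h i \o (@tnth _ T ^~ i)); last first.
  by apply/funext => t /=; rewrite tnth_mktuple.
exact: (measurableT_comp (mh i) (measurable_tnth i)).
Qed.

(** Measure-preserving maps act independently on the coordinates; stated through
    integrals, which is the form that Tonelli preserves. *)
Lemma ge0_integral_tuple_measure_map n (h : 'I_n -> T -> T) :
  (forall k, measurable_fun setT (h k)) ->
  (forall k (F : T -> \bar R), measurable_fun setT F -> (forall x, 0 <= F x) ->
     \int[m]_x F (h k x) = \int[m]_x F x) ->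
  forall F : n.-tuple T -> \bar R,
  measurable_fun setT F -> (forall t, 0 <= F t) ->
  \int[tm n]_t F [tuple h k (tnth t k) | k < n] = \int[tm n]_t F t.
Proof.
elim: n h => [|n IH] h mh hm F mF F0.
  by apply: eq_integral => t _; congr F; rewrite [LHS]tuple0 [RHS]tuple0.
rewrite !ge0_integral_tuple_measureS//; last first.
  exact: (measurableT_comp mF (measurable_tuple_map mh)).
have mG : measurable_fun setT (fun p : T * n.-tuple T => F (tcons p)).
  exact: (measurableT_comp mF (@measurable_tcons _ T n)).
rewrite -(hm ord0 (fun x => \int[tm n]_t F (tcons (x, t)))); last 2 first.
- exact: (measurable_fun_fubini_tonelli_F (fun p => F (tcons p))).
- by move=> x; apply: integral_ge0.
apply: eq_integral => x _.
rewrite -(IH (fun k => h (lift ord0 k)) _ _ (fun t => F (tcons (h ord0 x, t))))//.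
- apply: eq_integral => t _; congr F; apply: eq_from_tnth => i.
  rewrite tnth_mktuple; case: (unliftP ord0 i) => [j|] ->.
    by rewrite !tnthS tnth_mktuple.
  by rewrite !tnth0.
- by move=> k G mG' G0; exact: hm.
- exact: (measurableT_comp mF (@measurable_tcons_section n _)).
Qed.

End tuple_measure_integral.
End nonnegative_integrals.

(** * Affine substitutions in Lebesgue integrals *)

Section lebesgue_affine.
Local Open Scope ereal_scope.
Context (R : realType).
Local Notation mu := (@lebesgue_measure R).
Implicit Types F : R -> \bar R.

Lemma measurable_affine (a b : R) : measurable_fun setT (fun x : R => a * x + b)%R.
Proof. by apply: measurable_funD => //; exact: measurable_funM. Qed.

(** Both sides are measures in [A] that agree on half-open intervals. *)
Lemma lebesgue_measure_affine (a b : R) (A : set R) : (0 < a)%R -> measurable A ->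
  mu ((fun x : R => a * x + b)%R @^-1` A) = a^-1%:E * mu A.
Proof.
move=> a0 mA.
pose nu : {measure set (measurableTypeR R) -> \bar R} :=
  measure_function_pushforward__canonical__measure_function_Measure
    mu (measurable_affine a b : measurable_fun setT
         ((fun x => a * x + b)%R : measurableTypeR R -> measurableTypeR R)).
have a0' : (0 <= a)%R by exact: ltW.
rewrite (lebesgue_measure_unique (mu := mscale (NngNum a0') nu) _ mA)//=.
  by rewrite /mscale/= muleA -EFinM mulVf ?mul1e// gt_eqF.
move=> _ [[u v]] _ <-; rewrite /mscale/= /pushforward.
have -> : ((fun x => a * x + b)%R @^-1` `]u, v]%classic) =
    [set` `](u - b) / a, (v - b) / a]%R].
  by apply/seteqP; split => x /=; rewrite !in_itv/= ltr_pdivrMr// ler_pdivlMr//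
    ltrBlDr lerBrDr [(x * a)%R]mulrC.
rewrite !lebesgue_measure_itv/= !lte_fin ltr_pM2r ?invr_gt0// ltrD2r.
case: ifPn => _; rewrite ?mule0// -!EFinD -EFinM; congr EFin.
by field; rewrite gt_eqF.
Qed.

Lemma ge0_integral_affine (a b : R) F : (0 < a)%R ->
  measurable_fun setT F -> (forall x, 0 <= F x) ->
  \int[mu]_x F (a * x + b)%R = a^-1%:E * \int[mu]_x F x.
Proof.
move=> a0 mF F0.
have a0' : (0 <= a^-1)%R by rewrite invr_ge0 ltW.
rewrite -(@ge0_integral_mscale _ (measurableTypeR R) _ mu _ measurableT (NngNum a0'))//.
have maff : measurable_fun setT
  ((fun x => a * x + b)%R : measurableTypeR R -> measurableTypeR R).
  exact: measurable_affine.
rewrite -[LHS](ge0_integral_pushforward maff mu measurableT)//=.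
apply: eq_measure_integral => A mA _.
exact: lebesgue_measure_affine.
Qed.

Lemma ge0_integral_translate (b : R) F :
  measurable_fun setT F -> (forall x, 0 <= F x) ->
  \int[mu]_x F (x + b)%R = \int[mu]_x F x.
Proof.
move=> mF F0; have := ge0_integral_affine b ltr01 mF F0.
by rewrite invr1 mul1e => <-; apply: eq_integral => x _; rewrite mul1r.
Qed.

End lebesgue_affine.

(** * Area-preserving linear maps of the plane *)

Section plane.
Local Open Scope ereal_scope.
Context (R : realType).
Local Notation mu := (@lebesgue_measure R).
Local Notation mu2 := (product_measure1 mu mu).
Implicit Types F : R * R -> \bar R.

Lemma measurable_linear2 (a b c d : R) : measurable_fun setT
  (fun p : R * R => (a * p.1 + b * p.2, c * p.1 + d * p.2)%R).
Proof.
by apply: measurable_fun_pair; apply: measurable_funD; apply: measurable_funM.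
Qed.

Lemma ge0_integral_shear1 (t : R) F :
  measurable_fun setT F -> (forall p, 0 <= F p) ->
  \int[mu2]_p F (p.1 + t * p.2, p.2)%R = \int[mu2]_p F p.
Proof.
move=> mF F0.
have mG : measurable_fun setT (fun p : R * R => F (p.1 + t * p.2, p.2)%R).
  apply: (measurableT_comp mF); apply: measurable_fun_pair => //.
  by apply: measurable_funD => //; exact: measurable_funM.
rewrite (fubini_tonelli2 (m1 := mu) (m2 := mu) F)//.
rewrite (fubini_tonelli2 (m1 := mu) (m2 := mu) (fun p : R * R => F (p.1 + t * p.2, p.2)%R))//.
apply: eq_integral => y _; rewrite /fubini_G/=.
rewrite (ge0_integral_translate _ (F := fun x => F (x, y)))//.
exact: measurableT_comp.
Qed.

Lemma ge0_integral_shear2 (t : R) F :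
  measurable_fun setT F -> (forall p, 0 <= F p) ->
  \int[mu2]_p F (p.1, p.2 + t * p.1)%R = \int[mu2]_p F p.
Proof.
move=> mF F0.
have mG : measurable_fun setT (fun p : R * R => F (p.1, p.2 + t * p.1)%R).
  apply: (measurableT_comp mF); apply: measurable_fun_pair => //.
  by apply: measurable_funD => //; exact: measurable_funM.
rewrite (fubini_tonelli1 (m1 := mu) (m2 := mu) F)//.
rewrite (fubini_tonelli1 (m1 := mu) (m2 := mu) (fun p : R * R => F (p.1, p.2 + t * p.1)%R))//.
apply: eq_integral => x _; rewrite /fubini_F/=.
rewrite (ge0_integral_translate _ (F := fun y => F (x, y)))//.
exact: measurableT_comp.
Qed.

(** One factor [a^-1] comes from each coordinate. *)
Lemma ge0_integral_homothety (a : R) F : (0 < a)%R ->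
  measurable_fun setT F -> (forall p, 0 <= F p) ->
  \int[mu2]_p F (a * p.1, a * p.2)%R = (a ^- 2)%:E * \int[mu2]_p F p.
Proof.
move=> a0 mF F0.
have mG : measurable_fun setT (fun p : R * R => F (a * p.1, a * p.2)%R).
  by apply: (measurableT_comp mF); apply: measurable_fun_pair => //; exact: measurable_funM.
have scale (G : R -> \bar R) : measurable_fun setT G -> (forall x, 0 <= G x) ->
    \int[mu]_x G (a * x)%R = a^-1%:E * \int[mu]_x G x.
  move=> mH H0; rewrite -(ge0_integral_affine 0 a0 mH H0).
  by apply: eq_integral => x _; rewrite addr0.
rewrite (fubini_tonelli1 (m1 := mu) (m2 := mu) F)//.
rewrite (fubini_tonelli1 (m1 := mu) (m2 := mu) (fun p : R * R => F (a * p.1, a * p.2)%R))//.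
rewrite /fubini_F/=.
rewrite expr2 invfM EFinM -muleA -scale; last 2 first.
- exact: (measurable_fun_fubini_tonelli_F (m2 := mu) F).
- by move=> x; exact: integral_ge0.
rewrite -ge0_integralZl//; last 3 first.
- have mI : measurable_fun setT (fun x : R => \int[mu]_y F (x, y)).
    exact: (measurable_fun_fubini_tonelli_F (m2 := mu) F).
  have ma : measurable_fun setT (fun x : R => a * x)%R by exact: measurable_funM.
  exact: (measurableT_comp mI ma).
- by move=> x _; exact: integral_ge0.
- by rewrite lee_fin invr_ge0 ltW.
apply: eq_integral => x _; rewrite (scale (fun y => F (a * x, y)%R))//.
exact: measurableT_comp.
Qed.

(** The rotation with cosine [c] and sine [s] is the product of the horizontal shear of
    slope [t = (c - 1) / s], the vertical shear of slope [s] and again the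
    horizontal shear of slope [t]; hence the condition [s != 0]. *)
Lemma ge0_integral_rotation2 (c s : R) F :
  (c ^+ 2 + s ^+ 2 = 1)%R -> s != 0%R ->
  measurable_fun setT F -> (forall p, 0 <= F p) ->
  \int[mu2]_p F (c * p.1 - s * p.2, s * p.1 + c * p.2)%R = \int[mu2]_p F p.
Proof.
move=> cs s0 mF F0; pose t := ((c - 1) / s)%R.
pose H (p : R * R) := F (p.1 + t * p.2, p.2)%R.
have mH : measurable_fun setT H.
  apply: (measurableT_comp mF); apply: measurable_fun_pair => //.
  by apply: measurable_funD => //; exact: measurable_funM.
pose G (p : R * R) := H (p.1, p.2 + s * p.1)%R.
have mG : measurable_fun setT G.
  apply: (measurableT_comp mH); apply: measurable_fun_pair => //.
  by apply: measurable_funD => //; exact: measurable_funM.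
rewrite -(ge0_integral_shear1 t mF F0) -/H.
rewrite -(ge0_integral_shear2 s mH); last by move=> p; exact: F0.
rewrite -(ge0_integral_shear1 t mG); last by move=> p; exact: F0.
apply: eq_integral => -[x y] _; rewrite /G /H/=; congr (F (_, _)); rewrite /t.
  have -> : ((c - 1) / s * (y + s * (x + (c - 1) / s * y)) =
    (c - 1) / s * y + (c - 1) * x + (c - 1) ^+ 2 / s * y)%R by field.
  rewrite [in RHS]addrA.
  have -> : (s * y = s ^+ 2 / s * y)%R by field.
  by rewrite (_ : s ^+ 2 = 1 - c ^+ 2)%R; [field|rewrite -cs; ring].
by field.
Qed.

End plane.

(** * Rotation invariance of the area measure *)

Section complex_integral.
Local Open Scope ereal_scope.
Context (R : realType).
Local Notation mu := (@lebesgue_measure R).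
Local Notation mu2 := (product_measure1 mu mu).
Local Notation area := (@area R).
Implicit Types (F : R[i] -> \bar R) (w z : R[i]).

Lemma ge0_integral_area F : measurable_fun setT F -> (forall z, 0 <= F z) ->
  \int[area]_z F z = \int[mu2]_p F (complex_of_pair p).
Proof.
move=> mF F0.
pose nu : {measure set R[i] -> \bar R} :=
  measure_function_pushforward__canonical__measure_function_Measure
    mu2 (@measurable_complex_of_pair R).
rewrite (eq_measure_integral nu)// ge0_integral_pushforward//.
exact: measurable_complex_of_pair.
Qed.

Lemma measurable_mulc w : measurable_fun setT (fun z : R[i] => w * z)%R.
Proof.
rewrite (_ : (fun z => _) = @complex_of_pair R \o
    (fun p : R * R => (complex.Re w * p.1 + - complex.Im w * p.2,
                       complex.Im w * p.1 + complex.Re w * p.2)%R) \o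
    @pair_of_complex R); last first.
  apply/funext => -[x y]; case: w => a b /=.
  by rewrite /complex_of_pair/= mulNr [X in _ = Complex _ X]addrC.
apply: measurableT_comp (@measurable_pair_of_complex R).
apply: measurableT_comp (@measurable_complex_of_pair R) _.
exact: measurable_linear2.
Qed.

(** Unit numbers off the real axis are products of three shears; the others are
    products of two such numbers. *)
Lemma ge0_integral_area_rotation w F : normc w = 1%R ->
  measurable_fun setT F -> (forall z, 0 <= F z) ->
  \int[area]_z F (w * z)%R = \int[area]_z F z.
Proof.
have rot0 (v : R[i]) (G : R[i] -> \bar R) : complex.Im v != 0%R -> normc v = 1%R ->
    measurable_fun setT G -> (forall z, 0 <= G z) ->
    \int[area]_z G (v * z)%R = \int[area]_z G z.
  case: v => c s /= s0 v1 mG G0.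
  have cs : (c ^+ 2 + s ^+ 2 = 1)%R.
    by rewrite -[LHS]sqr_sqrtr ?v1 ?expr1n// addr_ge0// sqr_ge0.
  rewrite !ge0_integral_area//; last first.
    exact: (measurableT_comp mG (measurable_mulc _)).
  rewrite -(ge0_integral_rotation2 cs s0 (F := fun p => G (complex_of_pair p)))//.
    apply: eq_integral => -[x y] _; congr G.
    by rewrite /complex_of_pair/= [X in Complex _ X = _]addrC.
  exact: (measurableT_comp mG (@measurable_complex_of_pair R)).
move=> w1 mF F0.
have [w0|] := eqVneq (complex.Im w) 0%R; last by move=> w0; exact: rot0.
(* a real w is the product of the two non-real unit numbers -w i and i *)
have i1 : normc ('i%C : R[i]) = 1%R.
  by rewrite /normc/= expr0n expr1n add0r sqrtr1.
have wi : (w = (- w * 'i%C) * 'i%C)%R.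
  by rewrite -mulrA -expr2 sqr_i mulrN1 opprK.
rewrite -(rot0 (- w * 'i%C)%R F)//; last 2 first.
- case: w w0 w1 {wi} => a b /= ->; rewrite expr0n addr0 sqrtr_sqr => a1.
  rewrite mulr0 mulr1 addr0 oppr_eq0; apply: contra_eq_neq a1 => ->.
  by rewrite normr0 eq_sym oner_eq0.
- by rewrite normcM normcN w1 i1 mulr1.
rewrite -(rot0 'i%C (fun z => F (- w * 'i%C * z)%R))//.
- by apply: eq_integral => z _; rewrite mulrA -wi.
- by rewrite /= oner_eq0.
- exact: (measurableT_comp mF (measurable_mulc _)).
Qed.

End complex_integral.

(** * The area measure in the variable |z|^2 *)

Section radial.
Local Open Scope ereal_scope.
Context (R : realType).
Local Notation mu := (@lebesgue_measure R).
Local Notation mu2 := (product_measure1 mu mu).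
Local Notation area := (@area R).
Local Notation sqnorm := (fun z : R[i] => normc z ^+ 2)%R.
Local Notation disc r := [set z : R[i] | (normc z ^+ 2 <= r)%R].

Lemma measurable_sqnorm : measurable_fun setT sqnorm.
Proof. by apply: measurable_funX; exact: measurable_normc. Qed.

Lemma measurable_disc r : measurable (disc r).
Proof.
rewrite (_ : disc r = sqnorm @^-1` `]-oo, r]); last first.
  by apply/seteqP; split => z /=; rewrite in_itv.
by rewrite -[X in measurable X]setTI; exact: measurable_sqnorm.
Qed.

(** The homothety of ratio [r ^ (-1/2)] maps the disc to the unit disc. *)
Lemma area_disc r : (0 < r)%R -> area (disc r) = r%:E * area (disc 1).
Proof.
move=> r0; have mD := measurable_disc.
have areaE (D : set R[i]) : measurable D ->
    area D = \int[mu2]_p (\1_D (complex_of_pair p))%:E.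
  move=> mD'; rewrite -(ge0_integral_area (F := fun z => (\1_D z)%:E)); last 2 first.
  - exact/measurable_EFinP/measurable_indic.
  - by move=> z; rewrite lee_fin.
  by rewrite integral_indic// setIT.
pose a := (Num.sqrt r)^-1%R.
have a0 : (0 < a)%R by rewrite invr_gt0 sqrtr_gt0.
have a2 : (a ^- 2 = r)%R by rewrite exprVn invrK sqr_sqrtr// ltW.
rewrite !areaE// -{2}a2.
rewrite -(ge0_integral_homothety a0
  (F := fun p => (\1_(disc 1) (complex_of_pair p))%:E)); last 2 first.
- apply/measurable_EFinP.
  exact: (measurableT_comp (measurable_indic (mD 1%R)) (@measurable_complex_of_pair R)).
- by move=> p; rewrite lee_fin.
apply: eq_integral => -[x y] _; congr EFin; rewrite !indicE; congr (nat_of_bool _)%:R.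
apply/idP/idP; rewrite !inE/= /complex_of_pair /normc/= !sqr_sqrtr ?addr_ge0 ?sqr_ge0//.
  by rewrite !exprMn -mulrDr -[(a ^+ 2)%R]invrK a2 ler_pdivrMl// mulr1.
by rewrite !exprMn -mulrDr -[(a ^+ 2)%R]invrK a2 ler_pdivrMl// mulr1.
Qed.

Lemma area_disc0 : area (disc 0) = 0.
Proof.
have -> : area (disc 0) = mu2 ([set 0%R] `*` [set 0%R]).
  congr (mu2 _); apply/seteqP; split => -[x y] /=; rewrite /normc/= sqr_sqrtr ?addr_ge0 ?sqr_ge0//.
    move=> xy; have x2 := sqr_ge0 x; have y2 := sqr_ge0 y.
    by split; apply/eqP; rewrite -sqrf_eq0; apply/eqP; lra.
  by move=> [-> ->]; rewrite expr0n addr0.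
by rewrite product_measure1E//= lebesgue_measure_set1 mule0.
Qed.

(** The maximum covers negative [r], where the disc is empty. *)
Lemma area_disc_max r : area (disc r) = (Num.max r 0)%:E * area (disc 1).
Proof.
case: (ltgtP r 0%R) => [r0|r0|->].
- rewrite mul0e (_ : disc r = set0) ?measure0//.
  by apply/seteqP; split => // z /= /le_lt_trans/(_ r0); rewrite ltNge sqr_ge0.
- exact: area_disc.
- by rewrite area_disc0 mul0e.
Qed.

(** The unit disc lies in the square of side two. *)
Lemma area_disc1_lty : area (disc 1) < +oo.
Proof.
have mI : measurable ([set` `[-1, 1]%R] : set R) by [].
apply: (@le_lt_trans _ _ (mu2 ([set` `[-1, 1]%R] `*` [set` `[-1, 1]%R]))).
  apply: (le_measure (mu \x mu)%E); rewrite ?inE//.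
  - rewrite -[X in measurable X]setTI; apply: (@measurable_complex_of_pair R) => //.
    exact: measurable_disc.
  - exact: measurableX.
  - move=> [x y]; rewrite /= /normc/= !in_itv/= sqr_sqrtr ?addr_ge0 ?sqr_ge0// => xy.
    by split; apply/andP; split; nra.
rewrite product_measure1E//= !lebesgue_measure_itv/= lte_fin.
by case: ifP => _; rewrite -?EFinD -?EFinM ?mule0 ltry.
Qed.

(** The unit disc contains a square. *)
Lemma area_disc1_gt0 : 0 < area (disc 1).
Proof.
have mI : measurable ([set` `[0, 2^-1]%R] : set R) by [].
apply: (@lt_le_trans _ _ (mu2 ([set` `[0, 2^-1]%R] `*` [set` `[0, 2^-1]%R]))).
  rewrite product_measure1E//= !lebesgue_measure_itv/= lte_fin invr_gt0 ltr0n.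
  by rewrite -!EFinD -EFinM lte_fin subr0 mulr_gt0// invr_gt0.
apply: (le_measure (mu \x mu)%E); rewrite ?inE//.
- exact: measurableX.
- rewrite -[X in measurable X]setTI; apply: (@measurable_complex_of_pair R) => //.
  exact: measurable_disc.
- move=> [x y] [/=]; rewrite /normc/= !in_itv/= sqr_sqrtr ?addr_ge0 ?sqr_ge0//.
  by move=> /andP[x0 x1] /andP[y0 y1]; nra.
Qed.

(** Half-open intervals pull back to annuli, whose area is a difference of areas of
    discs; half-open intervals determine a measure. *)
Lemma area_sqnorm_law (B : set R) : measurable B ->
  area (sqnorm @^-1` B) = area (disc 1) * mu (B `&` [set` `[0%R, +oo[%R]).
Proof.
move=> mB.
have mI : measurable ([set` `[0%R, +oo[%R] : set (measurableTypeR R)) by [].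
have c0 : (0 <= fine (area (disc 1)))%R by exact: fine_ge0.
pose m1 : {measure set (measurableTypeR R) -> \bar R} := mscale (NngNum c0) (mrestr mu mI).
pose m2 : {measure set (measurableTypeR R) -> \bar R} :=
  measure_function_pushforward__canonical__measure_function_Measure
    area (measurable_sqnorm : measurable_fun setT (sqnorm : R[i] -> measurableTypeR R)).
have cE : area (disc 1) = (fine (area (disc 1)))%:E.
  by rewrite fineK// ge0_fin_numE// area_disc1_lty.
rewrite cE -[LHS]/(m2 B) -[RHS]/(m1 B).
have m12 A : ocitv A -> m2 A = m1 A.
  move=> [[u v] _ <-]; rewrite /m1 /m2/= /pushforward /mscale/= /mrestr/=.
  have -> : sqnorm @^-1` [set` `]u, v]%R] = disc v `\` disc u.
    apply/seteqP; split => z /=; rewrite in_itv/=.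
      by move=> /andP[uz zv]; split => //; apply/negP; rewrite -ltNge.
    by move=> [-> /negP]; rewrite -ltNge => ->.
  have vfin : area (disc v) < +oo by rewrite area_disc_max cE -EFinM ltry.
  have -> : area (disc v `\` disc u) = area (disc v) - area (disc v `&` disc u).
    by apply: measureD => //; exact: measurable_disc.
  rewrite (_ : disc v `&` disc u = disc (Num.min u v)); last first.
    apply/seteqP; split => z /=; rewrite le_min.
      by move=> [-> ->].
    by move=> /andP[-> ->].
  rewrite (area_disc_max v) (area_disc_max (Num.min u v)) cE -!EFinM -EFinB.
  rewrite (_ : _ `&` _ = if (u < 0)%R then [set` `[0%R, v]%R] else [set` `]u, v]%R]); last first.
    have [u0|u0] := ltP u 0%R; apply/seteqP; split => x /=; rewrite !in_itv/= ?andbT.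
    - by move=> [/andP[_ ->] ->].
    - by move=> /andP[x0 ->]; rewrite x0 (lt_le_trans u0 x0).
    - by move=> [].
    - by move=> /andP[ux ->]; rewrite ux (le_trans u0 (ltW ux)).
  set c := fine _.
  have [u0|u0] := ltP u 0%R; rewrite lebesgue_measure_itv/= lte_fin.
    rewrite [Num.max (Num.min u v) _]max_r ?ge_min ?(ltW u0)//.
    have [v0|v0] := ltP 0%R v; last by rewrite mul0r subr0 mule0.
    by rewrite mul0r !subr0 oppr0 adde0 -EFinM mulrC.
  have [uv|vu] := ltP u v; last by rewrite subrr mule0.
  rewrite !max_l// ?(le_trans u0 (ltW uv))// -EFinD -EFinM; congr EFin; ring.
apply: (@measure_unique _ R (measurableTypeR R) (@ocitv R)
  (fun n => [set` `](- n%:R)%R, n%:R]%R]) _ _ _ _ m2 m1) => //.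
- exact: ocitvI.
- by move=> n; exact: is_ocitv.
- apply/seteqP; split => // x _; exists (Num.truncn `|x|).+1 => //=.
  have := truncnS_gt `|x|%R; rewrite ltr_norml in_itv/= => /andP[-> /ltW ->//].
- move=> n; apply: (@le_lt_trans _ _ (area (disc n%:R))).
    apply: (le_measure area); rewrite ?inE//.
    - rewrite -[X in measurable X]setTI; exact: measurable_sqnorm.
    - exact: measurable_disc.
    - by move=> z; rewrite /= in_itv/= => /andP[].
  by rewrite area_disc_max cE -EFinM ltry.
Qed.

(** This is integration in polar coordinates in the variable [t = |z|^2], with the
    angle integrated out. The constant is [pi]; it cancels in normalized averages, and
    positivity and finiteness are enough for that. *)
Lemma ge0_integral_area_radial : {c : R | (0 < c)%R &
  forall F : R -> \bar R, measurable_fun setT F -> (forall x, 0 <= F x) ->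
  \int[area]_z F (normc z ^+ 2)%R =
  \int[mu]_t (F t * (c * \1_[set` `[0%R, +oo[%R] t)%:E)}.
Proof.
have c0 := area_disc1_gt0; have cfin := area_disc1_lty.
have cgt0 : (0 < fine (area (disc 1)))%R by rewrite fine_gt0// c0.
exists (fine (area (disc 1))) => // F mF F0.
have cE : area (disc 1) = (fine (area (disc 1)))%:E.
  by rewrite fineK// ge0_fin_numE// cfin.
have ms : measurable_fun setT (sqnorm : R[i] -> measurableTypeR R).
  exact: measurable_sqnorm.
pose nu : {measure set (measurableTypeR R) -> \bar R} :=
  measure_function_pushforward__canonical__measure_function_Measure area ms.
transitivity (\int[nu]_x F x).
  by rewrite [RHS](ge0_integral_pushforward ms)// preimage_setT.
apply: ge0_integral_density => //.
- by apply: measurable_funM => //; exact: measurable_indic.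
- by move=> x; rewrite mulr_ge0// ltW.
- move=> A mA; rewrite /nu/= /pushforward area_sqnorm_law// cE.
  under eq_integral do rewrite EFinM.
  rewrite ge0_integralZl//; last by rewrite lee_fin ltW.
    by rewrite integral_indic// setIC.
  exact/measurable_EFinP/measurable_indic.
Qed.

End radial.

(** * Gamma densities *)

Section gamma.
Local Open Scope ereal_scope.
Context (R : realType).
Local Notation mu := (@lebesgue_measure R).
Local Notation half_line := [set` `[0%R, +oo[%R].

(** The density of the Gamma law of shape [l + 1] and scale one. *)
Definition gamma_pdf (l : nat) (t : R) : R :=
  (\1_half_line t * (t ^+ l * expR (- t) / l`!%:R))%R.

Lemma gamma_pdf_ge0 l t : (0 <= gamma_pdf l t)%R.
Proof.
rewrite /gamma_pdf indicE; case: (boolP (t \in _)); last by rewrite mul0r.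
rewrite inE/= in_itv/= andbT => t0; rewrite mul1r.
by rewrite divr_ge0 ?ler0n// mulr_ge0 ?exprn_ge0 ?expR_ge0.
Qed.

Lemma measurable_gamma_pdf l : measurable_fun setT (gamma_pdf l).
Proof.
apply: measurable_funM; first exact: measurable_indic.
apply: measurable_funM => //; apply: measurable_funM; first exact: measurable_funX.
by apply: measurableT_comp.
Qed.

Lemma exponential_pdf1E (t : R) : exponential_pdf 1 t = gamma_pdf 0 t.
Proof.
rewrite /exponential_pdf /gamma_pdf patchE indicE.
case: (boolP (t \in half_line)) => t0; last by rewrite mul0r.
by rewrite !mul1r fact0 divr1 mulN1r.
Qed.

Lemma integral_exprn (l : nat) (t : R) : (0 <= t)%R ->
  \int[mu]_(y in [set` `[0%R, t]%R]) (y ^+ l)%:E = (t ^+ l.+1 / l.+1%:R)%:E.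
Proof.
rewrite le_eqVlt => /predU1P[<-|t0].
  by rewrite set_itv1 integral_set1 expr0n mul0r.
rewrite (@continuous_FTC2 _ _ (fun y => y ^+ l.+1 / l.+1%:R)%R)//.
- by rewrite expr0n mul0r sube0.
- by apply: continuous_subspaceT => x; exact: exprn_continuous.
- split.
  + by move=> x _; apply: derivableM => //; exact: exprn_derivable.
  + apply: cvg_at_right_filter; apply: cvgM; last exact: cvg_cst.
    exact: exprn_continuous.
  + apply: cvg_at_left_filter; apply: cvgM; last exact: cvg_cst.
    exact: exprn_continuous.
- move=> x _; rewrite derive1Mr//; last exact: exprn_derivable.
  by rewrite exp_derive1 /= -[(_ *: _)%R]/(_ * _)%R mulrAC divff ?mul1r// pnatr_eq0.
Qed.

(** The exponential factors multiply to [e^(-t)], which leaves the integral of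
    [y^l] over the segment from [0] to [t]. *)
Lemma gamma_pdf_convolution l t :
  \int[mu]_y (gamma_pdf l y * gamma_pdf 0 (t - y))%:E = (gamma_pdf l.+1 t)%:E.
Proof.
have E y : (gamma_pdf l y * gamma_pdf 0 (t - y) =
    \1_[set` `[0%R, t]%R] y * y ^+ l * (expR (- t) / l`!%:R))%R.
  rewrite /gamma_pdf !indicE !mem_setE !in_itv/= !andbT subr_ge0.
  case: (0 <= y)%R; rewrite ?mul0r//= mul1r.
  case: (y <= t)%R; rewrite ?mul0r ?mulr0// !mul1r fact0 divr1.
  have -> : expR (- t) = (expR (- y) * expR (- (t - y)))%R by rewrite -expRD; congr expR; ring.
  by ring.
under eq_integral do rewrite E.
have [t0|t0] := ltP t 0%R.
  rewrite integral0_eq; last first.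
    move=> y _; rewrite indicE memNset ?mul0r//= in_itv/= => /andP[y0 yt].
    by move: (le_lt_trans (le_trans y0 yt) t0); rewrite ltxx.
  by rewrite /gamma_pdf indicE memNset ?mul0r//= in_itv/= andbT leNgt t0.
have mi : measurable_fun setT (fun y : R => \1_[set` `[0%R, t]%R] y * y ^+ l)%R.
  by apply: measurable_funM; [exact: measurable_indic|exact: measurable_funX].
have miE : measurable_fun setT (fun y : R => (\1_[set` `[0%R, t]%R] y * y ^+ l)%:E).
  exact/measurable_EFinP.
under eq_integral do rewrite EFinM.
rewrite ge0_integralZr//; last first.
  move=> y _; rewrite lee_fin indicE mem_setE in_itv/=.
  by case: (leP 0%R y) => [y0|]; rewrite ?mul0r// mulr_ge0// exprn_ge0.
rewrite (_ : \int[mu]_y _ = \int[mu]_(y in [set` `[0%R, t]%R]) (y ^+ l)%:E).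
  rewrite integral_exprn// -EFinM; congr EFin.
  rewrite /gamma_pdf indicE mem_set ?mul1r/=; last by rewrite in_itv/= t0.
  by rewrite factS natrM invfM; ring.
rewrite [RHS]integral_mkcond; apply: eq_integral => y _.
by rewrite patchE indicE; case: ifP; rewrite ?mul1r ?mul0r.
Qed.

End gamma.

(** * The law of partial sums of independent exponential variables *)

Section boxes.
Local Open Scope ereal_scope.
Context d (T : measurableType d) (n : nat).

Definition boxes : set (set (n.-tuple T)) :=
  [set [set t | forall i, A i (tnth t i)] |
    A in [set A : 'I_n -> set T | forall i, measurable (A i)]].

(** Preimages of measurable sets under one coordinate are boxes, and they generate. *)
Lemma measurable_boxes : measurable = <<s boxes >>.
Proof.
apply/seteqP; split.
  apply: smallest_sub; first exact: smallest_sigma_algebra.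
  rewrite -bigcup_seq => _ [i _ [B mB <-]]; rewrite setTI.
  apply: sub_sigma_algebra; exists (fun j => if j == i then B else setT).
    by move=> j; case: ifP.
  apply/seteqP; split => t /=; first by move=> /(_ i); rewrite eqxx.
  by move=> Bt j; case: eqP => [->|].
apply: smallest_sub; first exact: sigma_algebra_measurable.
move=> _ [A mA <-].
rewrite (_ : mkset _ = \bigcap_(i in [set: 'I_n]) ((@tnth _ T ^~ i) @^-1` A i)).
  apply: fin_bigcap_measurable => // i _; rewrite -[X in measurable X]setTI.
  exact: measurable_tnth.
by apply/seteqP; split => t /= H i; [move=> _|]; exact: H.
Qed.

Lemma setI_closed_boxes : setI_closed boxes.
Proof.
move=> _ _ [A mA <-] [B mB <-]; exists (fun i => A i `&` B i).
  by move=> i; exact: measurableI.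
by apply/seteqP; split => t /= => [H|[HA HB] i]; split => // i; have [] := H i.
Qed.

End boxes.

Section partial_sum_law.
Local Open Scope ereal_scope.
Context (R : realType).
Local Notation mu := (@lebesgue_measure R).

Lemma measurable_tuple_sum n : measurable_fun setT
  (fun t : n.-tuple R => \sum_(i < n) tnth t i)%R.
Proof. by apply: measurable_sum => i; exact: measurable_tnth. Qed.

(** By induction: Tonelli splits off one summand [x], the translation [t = x + y]
    turns the double integral into a convolution, and a second use of Tonelli
    brings the convolution inside. *)
Lemma tuple_measure_exponential_sum (nu : probability R R) (l : nat) (F : R -> \bar R) :
  (forall A, measurable A -> nu A = exponential_prob 1 A) ->
  measurable_fun setT F -> (forall x, 0 <= F x) ->
  \int[@tuple_measure _ _ _ nu l.+1]_t F (\sum_(i < l.+1) tnth t i)%R =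
  \int[mu]_t (F t * (gamma_pdf l t)%:E).
Proof.
move=> nuE.
have nu_int (G : R -> \bar R) : measurable_fun setT G -> (forall x, 0 <= G x) ->
    \int[nu]_x G x = \int[mu]_x (G x * (gamma_pdf 0 x)%:E).
  move=> mG G0.
  have mid : measurable_fun setT (idfun : R -> measurableTypeR R).
    by move=> _ A mA; rewrite preimage_id setTI.
  pose nu' : {measure set (measurableTypeR R) -> \bar R} :=
    measure_function_pushforward__canonical__measure_function_Measure nu mid.
  transitivity (\int[nu']_x G x); first by rewrite [RHS](ge0_integral_pushforward mid).
  apply: ge0_integral_density => //.
  - exact: measurable_gamma_pdf.
  - by move=> x; exact: gamma_pdf_ge0.
  - move=> A mA; rewrite [LHS]nuE//; apply: eq_integral => x _.
    by rewrite exponential_pdf1E.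
elim: l F => [|l IH] F mF F0.
  rewrite ge0_integral_tuple_measureS//; last first.
  exact: (measurableT_comp mF (@measurable_tuple_sum _)).
  rewrite -nu_int//; apply: eq_integral => x _.
  by rewrite ge0_integral_tuple_measure0// big_ord_recl big_ord0 addr0 tnth0.
rewrite ge0_integral_tuple_measureS//; last first.
  exact: (measurableT_comp mF (@measurable_tuple_sum _)).
have mg k := @measurable_gamma_pdf R k.
pose G (p : R * R) := F (p.1 + p.2)%R * ((gamma_pdf 0 p.1)%:E * (gamma_pdf l p.2)%:E).
pose H (p : R * R) := F p.1 * ((gamma_pdf 0 (p.1 - p.2))%:E * (gamma_pdf l p.2)%:E).
have G0 p : 0 <= G p by rewrite !mule_ge0// lee_fin gamma_pdf_ge0.
have H0 p : 0 <= H p by rewrite !mule_ge0// lee_fin gamma_pdf_ge0.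
have mG : measurable_fun setT G.
  apply: emeasurable_funM.
    by apply: (measurableT_comp mF); exact: measurable_funD.
  apply: emeasurable_funM; apply/measurable_EFinP.
    exact: (measurableT_comp (mg 0%N)).
  exact: (measurableT_comp (mg l)).
have mH : measurable_fun setT H.
  apply: emeasurable_funM; first exact: (measurableT_comp mF).
  apply: emeasurable_funM; apply/measurable_EFinP.
    by apply: (measurableT_comp (mg 0%N)); exact: measurable_funB.
  exact: (measurableT_comp (mg l)).
pose K (p : R * R) := F (p.1 + p.2)%R * (gamma_pdf l p.2)%:E.
have K0 p : 0 <= K p by rewrite mule_ge0// lee_fin gamma_pdf_ge0.
have mK : measurable_fun setT K.
  apply: emeasurable_funM.
    by apply: (measurableT_comp mF); exact: measurable_funD.
  by apply/measurable_EFinP; exact: (measurableT_comp (mg l)).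
transitivity (\int[mu]_x \int[mu]_y G (x, y)).
  transitivity (\int[nu]_x \int[mu]_y K (x, y)).
    apply: eq_integral => x _; rewrite -(IH (fun y => F (x + y)%R))//; last first.
      by apply: (measurableT_comp mF); exact: measurable_funD.
    apply: eq_integral => t _; rewrite big_ord_recl tnth0; congr (F (_ + _)%R).
    by apply: eq_bigr => i _; rewrite tnthS.
  rewrite nu_int; last 2 first.
  - exact: (measurable_fun_fubini_tonelli_F (m2 := mu) K).
  - by move=> x; apply: integral_ge0.
  apply: eq_integral => x _; rewrite -ge0_integralZr//; last 2 first.
  - exact: (measurableT_comp mK (pair1_measurable x)).
  - by rewrite lee_fin gamma_pdf_ge0.
  by apply: eq_integral => y _; rewrite /K /G/= -muleA [X in _ * X]muleC.
rewrite (fubini_tonelli (m1 := mu) (m2 := mu) G)//.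
transitivity (\int[mu]_y \int[mu]_t H (t, y)).
  apply: eq_integral => y _.
  rewrite -(ge0_integral_translate y (F := fun t => H (t, y)))//; last first.
    exact: (measurableT_comp mH (pair2_measurable y)).
  by apply: eq_integral => x _; rewrite /G /H/= addrK.
rewrite -(fubini_tonelli (m1 := mu) (m2 := mu) H)//.
apply: eq_integral => t _; rewrite -gamma_pdf_convolution /H/=.
have mgg : measurable_fun setT (fun y : R => (gamma_pdf l y * gamma_pdf 0 (t - y))%:E).
  apply/measurable_EFinP; apply: measurable_funM => //.
  by apply: (measurableT_comp (mg 0%N)); exact: measurable_funB.
rewrite -ge0_integralZl//.
  by apply: eq_integral => y _; rewrite -EFinM [X in F t * X%:E]mulrC.
by move=> y _; rewrite lee_fin mulr_ge0// gamma_pdf_ge0.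
Qed.

Context d (T : measurableType d) (P : probability T R) (X : nat -> {RV P >-> R}).

Definition initial_tuple n (w : T) : n.-tuple R := [tuple X i w | i < n].

Lemma measurable_initial_tuple n : measurable_fun setT (initial_tuple n).
Proof.
apply/measurable_fun_tnthP => i.
rewrite (_ : _ \o _ = X i)//; apply/funext => w /=.
by rewrite tnth_mktuple.
Qed.

(** Independence is the product rule on boxes, which form a generating family
    stable under intersection. The index set of the rule is the set of the
    first [n] naturals, and a family indexed by ordinals is extended by the
    full set beyond [n]. *)
Lemma initial_tuple_law (nu : probability R R) n (B : set (n.-tuple R)) :
  (forall k A, measurable A -> P (X k @^-1` A) = nu A) ->
  mutually_independent P (fun k => X k : T -> R) -> measurable B ->
  P (initial_tuple n @^-1` B) = @tuple_measure _ _ _ nu n B.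
Proof.
move=> Xnu Xind mB.
pose m1 : {measure set (n.-tuple R) -> \bar R} :=
  measure_function_pushforward__canonical__measure_function_Measure
    P (@measurable_initial_tuple n).
rewrite -[LHS]/(m1 B).
have boxT : boxes (setT : set (n.-tuple R)).
  by exists (fun=> setT) => //; apply/seteqP.
apply: (measure_unique (@boxes _ R n) (fun=> setT)) => //.
- exact: measurable_boxes.
- exact: setI_closed_boxes.
- by apply/seteqP; split => // t _; exists 0%N.
- move=> _ [A mA <-]; rewrite [RHS](@tuple_measure_box _ _ _ nu n A mA) /m1/= /pushforward.
  pose A' k := oapp A setT (insub k).
  have A'E (i : 'I_n) : A' i = A i by rewrite /A' valK.
  have mA' k : measurable (A' k) by rewrite /A'; case: insub => /=.
  pose J := [fset k in iota 0 n]%fset.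
  have := Xind J A' mA'.
  rewrite (perm_big (iota 0 n)); last first.
    apply: uniq_perm; rewrite ?fset_uniq ?iota_uniq// => k.
    by rewrite in_fset.
  rewrite -[X in iota 0 X]subn0 -/(index_iota 0 n) big_mkord.
  under [X in _ = X -> _]eq_bigr do rewrite A'E Xnu//.
  move=> <-; congr (P _); apply/seteqP; split => w /= H.
    move=> k; rewrite /= in_fset mem_iota add0n => /andP[_ kn].
    have := H (Ordinal kn); rewrite tnth_mktuple.
    by rewrite -(A'E (Ordinal kn)).
  move=> i; rewrite tnth_mktuple -A'E; apply: H.
  by rewrite /= in_fset mem_iota/= add0n.
- by move=> _; rewrite (_ : m1 setT = 1) ?ltry// /m1/= /pushforward preimage_setT probability_setT.
Qed.

Lemma partial_sum_exponential_law (l : nat) (F : R -> \bar R) :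
  (forall k, has_law P (X k) (exponential_prob 1)) ->
  mutually_independent P (fun k => X k : T -> R) ->
  measurable_fun setT F -> (forall x, 0 <= F x) ->
  \int[P]_w F (partial_sum (fun k => X k : T -> R) l.+1 w) =
  \int[mu]_t (F t * (gamma_pdf l t)%:E).
Proof.
move=> Xlaw Xind mF F0.
pose nu := distribution P (X 0).
rewrite -(@tuple_measure_exponential_sum nu)//; last exact: Xlaw.
have mi := @measurable_initial_tuple l.+1.
pose m1 : {measure set (l.+1.-tuple R) -> \bar R} :=
  measure_function_pushforward__canonical__measure_function_Measure P mi.
transitivity (\int[m1]_t F (\sum_(i < l.+1) tnth t i)%R).
  rewrite [RHS](ge0_integral_pushforward mi)//.
    rewrite preimage_setT; apply: eq_integral => w _ /=; congr F.
    by apply: eq_bigr => i _; rewrite tnth_mktuple.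
  exact: (measurableT_comp mF (@measurable_tuple_sum _)).
apply: eq_measure_integral => B mB _; apply: initial_tuple_law => //.
by move=> k A mA; rewrite /nu/= /distribution/= /pushforward [LHS]Xlaw// [RHS]Xlaw.
Qed.

End partial_sum_law.

(** * Gaussian integrals of radial functions against the Vandermonde weight *)

Section ginibre_integrals.
Local Open Scope ereal_scope.
Context (R : realType) (N : nat) (N0 : (0 < N)%N).
Local Notation mu := (@lebesgue_measure R).
Local Notation gm := (@gaussian_measure R N).

Lemma ge0_integral_gaussian (F : R[i] -> \bar R) :
  measurable_fun setT F -> (forall z, 0 <= F z) ->
  \int[gm]_z F z = \int[@area R]_z (F z * (gaussian_density N z)%:E).
Proof.
move=> mF F0; apply: ge0_integral_density => //.
- exact: measurable_gaussian_density.
- by move=> z; exact: expR_ge0.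
Qed.

Lemma ge0_integral_gaussian_rotation w (F : R[i] -> \bar R) : normc w = 1%R ->
  measurable_fun setT F -> (forall z, 0 <= F z) ->
  \int[gm]_z F (w * z)%R = \int[gm]_z F z.
Proof.
move=> w1 mF F0; rewrite !ge0_integral_gaussian//; last first.
  exact: (measurableT_comp mF (measurable_mulc w)).
rewrite -(ge0_integral_area_rotation w1 (F := fun z => F z * (gaussian_density N z)%:E)).
- by apply: eq_integral => z _; rewrite /gaussian_density normcM w1 mul1r.
- apply: emeasurable_funM => //; apply/measurable_EFinP.
  exact: measurable_gaussian_density.
- by move=> z; rewrite mule_ge0// lee_fin expR_ge0.
Qed.

Definition scaled_sqrt (t : R) : R := Num.sqrt (N%:R^-1 * t).

Lemma measurable_sqrt : measurable_fun setT (@Num.sqrt R).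
Proof. by apply: continuous_measurable_fun; exact: sqrt_continuous. Qed.

Lemma measurable_scaled_sqrt : measurable_fun setT scaled_sqrt.
Proof.
apply: (measurableT_comp measurable_sqrt); exact: measurable_funM.
Qed.

(** In the variable [t = N |z|^2] the Gaussian weight becomes [e^(-t)] and
    [|z|^(2 j)] becomes a multiple of [t^j], that is, the Gamma density up to a
    constant. The constants depend on [j] alone, which makes them cancel against
    the normalization. *)
Lemma gaussian_radial_moment : {M : nat -> R | (forall j, 0 < M j)%R &
  forall j (phi : R -> R), measurable_fun setT phi -> (forall x, 0 <= phi x)%R ->
  \int[gm]_z (phi (normc z) * (normc z ^+ 2) ^+ j)%:E =
  (M j)%:E * \int[mu]_t ((phi (scaled_sqrt t))%:E * (gamma_pdf j t)%:E)}.
Proof.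
have [c c0 radial] := ge0_integral_area_radial R.
have NR : (0 < N%:R :> R)%R by rewrite ltr0n.
have NR' : (0 < N%:R^-1 :> R)%R by rewrite invr_gt0.
have nN : N%:R != 0%R :> R by rewrite gt_eqF.
(* [N^-1] is the Jacobian of [t = N u]; the rest compares [u^j] with the Gamma
   density, [c] being the constant of the radial area formula *)
exists (fun j => N%:R^-1 * (c * j`!%:R / N%:R ^+ j))%R => [j|j phi mphi phi0].
  by rewrite mulr_gt0// divr_gt0 ?exprn_gt0// mulr_gt0// ltr0n fact_gt0.
(* the absolute value keeps [F] non-negative for [u < 0], where the image of
   the area measure vanishes *)
pose F (u : R) : R := (phi (Num.sqrt u) * `|u| ^+ j * expR (- (N%:R * u)))%R.
have F0 u : (0 <= F u)%R by rewrite !mulr_ge0 ?exprn_ge0 ?expR_ge0.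
have mF : measurable_fun setT F.
  apply: measurable_funM; last first.
    by apply: measurableT_comp => //; apply: measurableT_comp => //; exact: measurable_funM.
  apply: measurable_funM; first exact: (measurableT_comp mphi measurable_sqrt).
  by apply: measurable_funX; apply: normr_measurable.
transitivity (\int[@area R]_z (F (normc z ^+ 2)%R)%:E).
  rewrite ge0_integral_gaussian; last 2 first.
  - apply/measurable_EFinP; apply: measurable_funM.
      exact: (measurableT_comp mphi (@measurable_normc R)).
    apply: measurable_funX; exact: measurable_sqnorm.
  - by move=> z; rewrite lee_fin mulr_ge0// exprn_ge0// sqr_ge0.
  apply: eq_integral => z _; rewrite -EFinM /F sqrtr_sqr !ger0_norm ?sqr_ge0//.
  exact: normc_ge0.
rewrite (radial (fun u => (F u)%:E)); last 2 first.
- exact/measurable_EFinP.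
- by move=> u; rewrite lee_fin.
pose G (u : R) : R := (F u * (c * \1_[set` `[0%R, +oo[%R] u))%R.
have G0 u : (0 <= G u)%R by rewrite !mulr_ge0// ltW.
have mG : measurable_fun setT G.
  apply: measurable_funM => //; apply: measurable_funM => //; exact: measurable_indic.
have GE t : G (N%:R^-1 * t + 0)%R =
    ((c * j`!%:R / N%:R ^+ j) * (phi (scaled_sqrt t) * gamma_pdf j t))%R.
  rewrite addr0 /G /F /gamma_pdf !indicE !mem_setE !in_itv/= !andbT pmulr_rge0//.
  case: (leP 0%R t) => t0; last by rewrite !(mulr0, mul0r).
  rewrite ger0_norm ?mulr_ge0// 1?ltW// mulVKf// exprMn exprVn /scaled_sqrt.
  by field; rewrite pnatr_eq0 -lt0n fact_gt0 expf_neq0.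
transitivity (\int[mu]_u (G u)%:E); first by apply: eq_integral => u _; rewrite EFinM.
have aff : \int[mu]_u (G (N%:R^-1 * u + 0)%R)%:E = N%:R%:E * \int[mu]_u (G u)%:E.
  rewrite (ge0_integral_affine 0 NR' (F := fun u => (G u)%:E)) ?invrK//.
  exact/measurable_EFinP.
transitivity ((N%:R^-1)%:E * (N%:R%:E * \int[mu]_u (G u)%:E)).
  by rewrite muleA -EFinM mulVf// mul1e.
rewrite -aff (EFinM N%:R^-1) -[RHS]muleA; congr (_ * _).
under eq_integral do rewrite GE EFinM.
have mpg : measurable_fun setT (fun t : R => (phi (scaled_sqrt t) * gamma_pdf j t)%:E).
  apply/measurable_EFinP; apply: measurable_funM; last exact: measurable_gamma_pdf.
  exact: (measurableT_comp mphi measurable_scaled_sqrt).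
rewrite ge0_integralZl//.
- by move=> t _; rewrite lee_fin mulr_ge0// gamma_pdf_ge0.
- by rewrite lee_fin divr_ge0 ?exprn_ge0 ?ler0n// mulr_ge0 ?ler0n// ltW.
Qed.

Local Notation tm := (@tuple_measure _ _ _ gm N).

(** Each rotation of the coordinates by roots of unity fixes the radial factor and
    the measure, so the Vandermonde weight may be replaced by its average over all of them. *)
Lemma ge0_integral_vandermonde_radial (phi : 'I_N -> R -> R) :
  (forall k, measurable_fun setT (phi k)) -> (forall k x, 0 <= phi k x)%R ->
  \int[tm]_z ((\prod_(k < N) phi k (normc (tnth z k))) * vandermonde_sq z)%:E =
  \sum_(s : 'S_N) \prod_(k < N)
    \int[gm]_z (phi k (normc z) * (normc z ^+ 2) ^+ s k)%:E.
Proof.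
move=> mphi phi0.
have [w pw] := @exists_prim_root R[i] N N0.
pose Phi (z : N.-tuple R[i]) := (\prod_(k < N) phi k (normc (tnth z k)))%R.
pose perm (z : N.-tuple R[i]) :=
  (\sum_(s : 'S_N) \prod_(k < N) (normc (tnth z k) ^+ 2) ^+ s k)%R.
pose rot (j : {ffun 'I_N -> 'I_N}) (z : N.-tuple R[i]) :=
  [tuple (w ^+ j k * tnth z k)%R | k < N].
have Phi0 z : (0 <= Phi z)%R by apply: prodr_ge0.
have V0 (z : N.-tuple R[i]) : (0 <= vandermonde_sq z)%R.
  by apply: prodr_ge0 => i _; apply: prodr_ge0 => j _; exact: sqr_ge0.
have mphin k : measurable_fun setT (fun z : R[i] => phi k (normc z)).
  exact: (measurableT_comp (mphi k) (@measurable_normc R)).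
have mPhi : measurable_fun setT Phi.
  exact: (measurable_tuple_prod mphin).
have mV := @measurable_vandermonde_sq R N.
have mrot j : measurable_fun setT (rot j).
  exact: (measurable_tuple_map (fun k => measurable_mulc (w ^+ j k)%R)).
have w1 n : normc (w ^+ n)%R = 1%R by rewrite normcX (normc_prim_root pw) expr1n.
have Phi_rot j z : Phi (rot j z) = Phi z.
  by apply: eq_bigr => k _; rewrite tnth_mktuple normcM w1 mul1r.
have perm_mono (s : 'S_N) : (forall k, measurable_fun setT
    (fun z : R[i] => phi k (normc z) * (normc z ^+ 2) ^+ s k)%R).
  move=> k; apply: measurable_funM => //; apply: measurable_funX.
  exact: measurable_sqnorm.
have step (j : {ffun 'I_N -> 'I_N}) :
    \int[tm]_z (Phi z * vandermonde_sq z)%:E =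
    \int[tm]_z (Phi z * vandermonde_sq (rot j z))%:E.
  rewrite -[LHS](ge0_integral_tuple_measure_map (h := fun k z => w ^+ j k * z)%R).
  - by apply: eq_integral => z _; rewrite Phi_rot.
  - by move=> k; exact: measurable_mulc.
  - by move=> k F mF F0; exact: ge0_integral_gaussian_rotation.
  - by apply/measurable_EFinP; exact: measurable_funM.
  - by move=> z; rewrite lee_fin mulr_ge0.
have NN0 : (N ^ N)%:R != 0%R :> R by rewrite pnatr_eq0 expn_eq0 negb_and -lt0n N0.
transitivity (\int[tm]_z (Phi z * perm z)%:E).
  transitivity (((N ^ N)%:R^-1)%:E *
      \sum_(j : {ffun 'I_N -> 'I_N}) \int[tm]_z (Phi z * vandermonde_sq (rot j z))%:E).
    rewrite (eq_bigr (fun=> 1%:E * \int[tm]_z (Phi z * vandermonde_sq z)%:E)); last first.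
      by move=> j _; rewrite mul1e (step j).
    rewrite -ge0_sume_distrl// sumEFin sumr_const card_ffun !card_ord.
    by rewrite muleA -EFinM mulVf// mul1e.
  rewrite -ge0_integral_sum//; last 2 first.
  - move=> j; apply/measurable_EFinP; apply: measurable_funM => //.
    exact: (measurableT_comp mV (mrot j)).
  - by move=> j z _; rewrite lee_fin mulr_ge0.
  rewrite -ge0_integralZl//; last 2 first.
  - under eq_fun do rewrite sumEFin.
    apply/measurable_EFinP; apply: measurable_sum => j; apply: measurable_funM => //.
    exact: (measurableT_comp mV (mrot j)).
  - by move=> z _; apply: sume_ge0 => j _; rewrite lee_fin mulr_ge0.
  apply: eq_integral => z _; rewrite sumEFin -EFinM -mulr_sumr.
  by rewrite vandermonde_sq_torus_average// mulrCA mulKf.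
under eq_bigr => s _.
  rewrite -ge0_integral_tuple_measure_prod//; last first.
    by move=> k z; rewrite mulr_ge0// exprn_ge0// sqr_ge0.
  over.
rewrite -ge0_integral_sum//; last 2 first.
- by move=> s; apply/measurable_EFinP; exact: (measurable_tuple_prod (perm_mono s)).
- move=> s z _; rewrite lee_fin; apply: prodr_ge0 => k _.
  by rewrite mulr_ge0// exprn_ge0// sqr_ge0.
apply: eq_integral => z _; rewrite sumEFin /perm mulr_sumr; congr EFin.
by apply: eq_bigr => s _; rewrite big_split.
Qed.

End ginibre_integrals.

(** * Moments of linear statistics of the moduli *)

Section kostlan.
Local Open Scope ereal_scope.
Context (R : realType) (N : nat) (N0 : (0 < N)%N).
Local Notation mu := (@lebesgue_measure R).
Local Notation gm := (@gaussian_measure R N).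
Local Notation tm := (@tuple_measure _ _ _ gm N).
Local Notation G := (ginibre R N).

(** The total mass is a parameter here because it is only known after the weight
    has been integrated. *)
Lemma expectation_ginibre (Z : R) (Psi : N.-tuple R[i] -> R) :
  (0 < Z)%R -> \int[tm]_z (vandermonde_sq z)%:E = Z%:E ->
  measurable_fun setT Psi -> (forall z, 0 <= Psi z)%R ->
  'E_G[Psi] = (Z^-1)%:E * \int[tm]_z (Psi z * vandermonde_sq z)%:E.
Proof.
move=> Z0 WT mPsi Psi0; have mV := @measurable_vandermonde_sq R N.
have V0 (z : N.-tuple R[i]) : (0 <= vandermonde_sq z)%R.
  by apply: prodr_ge0 => i _; apply: prodr_ge0 => j _; exact: sqr_ge0.
have Zi : (0 <= Z^-1)%R by rewrite invr_ge0 ltW.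
have mPsiE : measurable_fun setT (fun z => (Psi z)%:E) by exact/measurable_EFinP.
have Psi0E z : setT z -> 0 <= (Psi z)%:E by move=> _; rewrite lee_fin.
have WT' : @ginibre_weight R N setT = Z%:E by exact: WT.
rewrite unlock.
rewrite (eq_measure_integral (mscale (NngNum Zi) (@ginibre_weight R N))).
  rewrite ge0_integral_mscale//.
  congr (_ * _); rewrite (@ge0_integral_density _ _ _ tm _ (@vandermonde_sq R N))//.
move=> A mA _; rewrite /ginibre/= /mnormalize/= WT' /mscale/=.
by rewrite eqe gt_eqF//= muleC.
Qed.

Context d (T : measurableType d) (P : probability T R) (eta : nat -> {RV P >-> R}).
Hypothesis eta_law : forall k, has_law P (eta k) (exponential_prob 1).
Hypothesis eta_indep : mutually_independent P (fun k => eta k : T -> R).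

Definition radius (l : nat) (w : T) : R :=
  Num.sqrt (N%:R^-1 * partial_sum (fun k => eta k : T -> R) l w).

(** The real value of an expectation that is finite on bounded functions. The shift
    in [l.+1] matches exponents, which start from zero, with the number of summands. *)
Definition radius_mean (l : nat) (phi : R -> R) : R :=
  fine 'E_P[fun w => phi (radius l.+1 w)].

Lemma measurable_radius l : measurable_fun setT (radius l).
Proof.
apply: (measurableT_comp (@measurable_sqrt R)); apply: measurable_funM => //.
by apply: measurable_sum => k.
Qed.

(** The class of test functions: closed under products, containing one, and with finite
    expectations. *)
Definition bounded_nonneg (phi : R -> R) :=
  measurable_fun setT phi /\ exists C, forall x, (0 <= phi x <= C)%R.

Lemma bounded_nonneg1 : bounded_nonneg (cst 1%R).
Proof. by split => //; exists 1%R => x; rewrite ler01 lexx. Qed.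

Lemma bounded_nonnegM phi psi : bounded_nonneg phi -> bounded_nonneg psi ->
  bounded_nonneg (fun x => phi x * psi x)%R.
Proof.
move=> [mphi [C hC]] [mpsi [D hD]]; split; first exact: measurable_funM.
exists (C * D)%R => x; have /andP[a b] := hC x; have /andP[c e] := hD x.
by rewrite mulr_ge0//= ler_pM.
Qed.

Lemma radius_meanE l phi : bounded_nonneg phi ->
  'E_P[fun w => phi (radius l.+1 w)] = (radius_mean l phi)%:E.
Proof.
move=> [mphi [C hC]]; rewrite /radius_mean fineK// ge0_fin_numE; last first.
  by apply: expectation_ge0 => w; case/andP: (hC (radius l.+1 w)).
have mr : measurable_fun setT (fun w => phi (radius l.+1 w)).
  exact: (measurableT_comp mphi (measurable_radius _)).
rewrite unlock; apply: (@le_lt_trans _ _ (\int[P]_w C%:E)).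
  apply: ge0_le_integral => //.
  - by move=> w _; rewrite lee_fin; case/andP: (hC (radius l.+1 w)).
  - exact/measurable_EFinP.
  - by move=> w _; rewrite lee_fin; case/andP: (hC (radius l.+1 w)).
by rewrite integral_cst//= probability_setT mule1 ltry.
Qed.

Lemma radius_mean1 l : radius_mean l (cst 1%R) = 1%R.
Proof. by rewrite /radius_mean expectation_cst. Qed.

(** The Gamma average in [gaussian_radial_moment] is an expectation over the
    radius, by [partial_sum_exponential_law]. *)
Lemma gaussian_moment_radius : {M : nat -> R | (forall j, 0 < M j)%R &
  forall j phi, bounded_nonneg phi ->
  \int[gm]_z (phi (normc z) * (normc z ^+ 2) ^+ j)%:E =
  (M j * radius_mean j phi)%:E}.
Proof.
have [M M0 moment] := @gaussian_radial_moment R N N0.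
exists M => // j phi [mphi [C hC]].
have phi0 x : (0 <= phi x)%R by case/andP: (hC x).
rewrite moment// EFinM -radius_meanE; last by split => //; exists C.
rewrite unlock; congr (_ * _).
rewrite -(@partial_sum_exponential_law R d T P eta j
  (fun t => (phi (scaled_sqrt N t))%:E) eta_law eta_indep)//.
- apply/measurable_EFinP.
  exact: (measurableT_comp mphi (@measurable_scaled_sqrt R N)).
- by move=> x; rewrite lee_fin.
Qed.

(** The moduli behave as a uniformly random relabelling of independent radii. The
    case where all factors are one computes the normalizing constant, in which
    the product of the moment constants appears for every permutation alike. *)
Lemma expectation_ginibre_radial_product (phi : 'I_N -> R -> R) :
  (forall k, bounded_nonneg (phi k)) ->
  'E_G[fun z => \prod_(k < N) phi k (normc (tnth z k))]%R =
  (N`!%:R^-1 * \sum_(s : 'S_N) \prod_(k < N) radius_mean (s k) (phi k))%:E.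
Proof.
move=> bphi.
have [M M0 moment] := gaussian_moment_radius.
have radial (psi : 'I_N -> R -> R) : (forall k, bounded_nonneg (psi k)) ->
    \int[tm]_z ((\prod_(k < N) psi k (normc (tnth z k))) * vandermonde_sq z)%:E =
    ((\prod_(j < N) M j) * \sum_(s : 'S_N) \prod_(k < N) radius_mean (s k) (psi k))%:E.
  move=> bpsi; rewrite ge0_integral_vandermonde_radial//; last 2 first.
  - by move=> k; have [] := bpsi k.
  - by move=> k x; have [_ [C hC]] := bpsi k; case/andP: (hC x).
  rewrite mulr_sumr -sumEFin; apply: eq_bigr => s _.
  under eq_bigr => k _ do rewrite moment//.
  rewrite prodEFin big_split/=; congr (_ * _)%:E.
  by rewrite [RHS](reindex_inj (@perm_inj _ s)).
pose Z : R := ((\prod_(j < N) M j) * N`!%:R)%R.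
have PM0 : (0 < \prod_(j < N) M j)%R by apply: prodr_gt0.
have F0 : (0 < N`!%:R :> R)%R by rewrite ltr0n fact_gt0.
have Z0 : (0 < Z)%R by rewrite mulr_gt0.
rewrite (expectation_ginibre Z0).
- rewrite radial// -EFinM; congr EFin.
  rewrite /Z invfM -mulrA [(N`!%:R^-1 * (_ * _))%R]mulrCA mulKf//.
  by rewrite gt_eqF.
- transitivity (\int[tm]_z ((\prod_(k < N) cst 1 (normc (tnth z k))) * vandermonde_sq z)%:E).
    by apply: eq_integral => z _; rewrite big1 ?mul1r.
  rewrite (radial (fun=> cst 1%R)) => [|k]; last exact: bounded_nonneg1.
  congr (_ * _)%:E; rewrite (eq_bigr (fun=> 1%R)) ?sumr_const ?card_Sn// => s _.
  by rewrite big1// => k _; exact: radius_mean1.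
- apply: (@measurable_tuple_prod _ _ R N (fun k z => phi k (normc z))) => k.
  by have [mphi _] := bphi k; exact: (measurableT_comp mphi (@measurable_normc R)).
- move=> z; apply: prodr_ge0 => k _; have [_ [C hC]] := bphi k.
  by case/andP: (hC (normc (tnth z k))).
Qed.

Lemma bounded_nonneg_ge0 phi x : bounded_nonneg phi -> (0 <= phi x)%R.
Proof. by move=> [_ [C hC]]; case/andP: (hC x). Qed.

Lemma expectation_ginibre_moduli f : bounded_nonneg f ->
  'E_G[moduli_statistic f] = (\sum_(l < N) radius_mean l f)%:E.
Proof.
move=> bf; have [mf _] := bf.
have F0 : N`!%:R != 0%R :> R by rewrite pnatr_eq0 -lt0n fact_gt0.
pose phi (k i : 'I_N) := if i == k then f else cst 1%R.
have bphi k i : bounded_nonneg (phi k i).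
  by rewrite /phi; case: eqP => // _; exact: bounded_nonneg1.
have phiE k (x : 'I_N -> R) : (\prod_(i < N) phi k i (x i) = f (x k))%R.
  rewrite (bigD1 k)//= /phi eqxx big1 ?mulr1// => i /negbTE ->; by [].
rewrite unlock.
under eq_integral do rewrite -sumEFin.
rewrite ge0_integral_sum//; last 2 first.
- move=> k; apply/measurable_EFinP; apply: (measurableT_comp mf).
  exact: (measurableT_comp (@measurable_normc R) (measurable_tnth k)).
- by move=> k z _; rewrite lee_fin bounded_nonneg_ge0.
transitivity (\sum_(k < N) (N`!%:R^-1 * \sum_(s : 'S_N) radius_mean (s k) f)%:E).
  apply: eq_bigr => k _.
  have := expectation_ginibre_radial_product (bphi k); rewrite unlock => pE.
  transitivity (\int[G]_z (\prod_(i < N) phi k i (normc (tnth z i)))%:E).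
    by apply: eq_integral => z _; rewrite (phiE k (fun i => normc (tnth z i))).
  rewrite pE; congr (_ * _)%:E; apply: eq_bigr => s _.
  rewrite (bigD1 k)//= /phi eqxx big1 ?mulr1// => i /negbTE ->.
  exact: radius_mean1.
rewrite sumEFin -mulr_sumr exchange_big/=; congr EFin.
rewrite (eq_bigr (fun=> \sum_(l < N) radius_mean l f)%R); last first.
  by move=> s _; rewrite [RHS](reindex_inj (@perm_inj _ s)).
by rewrite sumr_const card_Sn -[X in (_ * X)%R]mulr_natl mulKf.
Qed.

(** Each pair of indices gives a radial product with at most two factors different
    from one; summing over all pairs makes the relabelling by a permutation
    disappear. The coinciding pairs produce the diagonal terms. *)
Lemma expectation_ginibre_moduliM f g : bounded_nonneg f -> bounded_nonneg g ->
  'E_G[fun z => (moduli_statistic f z * moduli_statistic g z)%R] =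
  (\sum_(l < N) \sum_(m < N)
     if l == m then radius_mean l (fun x => f x * g x)%R
     else (radius_mean l f * radius_mean m g)%R)%:E.
Proof.
move=> bf bg; have bfg := bounded_nonnegM bf bg.
have [mf _] := bf; have [mg _] := bg.
have F0 : N`!%:R != 0%R :> R by rewrite pnatr_eq0 -lt0n fact_gt0.
pose a (l m : 'I_N) := if l == m then radius_mean l (fun x => f x * g x)%R
     else (radius_mean l f * radius_mean m g)%R.
pose phi (k j i : 'I_N) := if i == k then if i == j then (fun x => f x * g x)%R else f
  else if i == j then g else cst 1%R.
have bphi k j i : bounded_nonneg (phi k j i).
  by rewrite /phi; case: eqP => _; case: eqP => // _; exact: bounded_nonneg1.
have prodE (psi : 'I_N -> (R -> R) -> R) k j : (forall i, psi i (cst 1) = 1)%R ->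
    (\prod_(i < N) psi i (phi k j i) =
     if k == j then psi k (fun x => f x * g x) else psi k f * psi j g)%R.
  move=> psi1; rewrite (bigD1 k)//= {1}/phi eqxx.
  have [<-|kj] := eqVneq k j.
    by rewrite big1 ?mulr1// => i /negbTE ik; rewrite /phi ik psi1.
  rewrite (bigD1 j)/=; last by rewrite eq_sym.
  rewrite {1}/phi [j == k]eq_sym (negbTE kj) eqxx big1 ?mulr1//.
  by move=> i /andP[/negbTE ik /negbTE ij]; rewrite /phi ik ij psi1.
rewrite unlock.
under eq_integral do rewrite /moduli_statistic big_distrlr/= -sumEFin.
have msum k j : measurable_fun setT
    (fun z : N.-tuple R[i] => f (normc (tnth z k)) * g (normc (tnth z j)))%R.
  by apply: measurable_funM; [apply: (measurableT_comp mf)|apply: (measurableT_comp mg)];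
    exact: (measurableT_comp (@measurable_normc R) (measurable_tnth _)).
have sum0 k j (z : N.-tuple R[i]) : (0 <= f (normc (tnth z k)) * g (normc (tnth z j)))%R.
  by rewrite mulr_ge0// bounded_nonneg_ge0.
rewrite ge0_integral_sum//; last 2 first.
- by move=> k; apply/measurable_EFinP; apply: measurable_sum => j.
- by move=> k z _; rewrite lee_fin sumr_ge0.
transitivity (\sum_(k < N) \sum_(j < N)
    (N`!%:R^-1 * \sum_(s : 'S_N) a (s k) (s j))%:E).
  apply: eq_bigr => k _.
  under eq_integral do rewrite -sumEFin.
  rewrite ge0_integral_sum//; last 2 first.
  - by move=> j; apply/measurable_EFinP.
  - by move=> j z _; rewrite lee_fin.
  apply: eq_bigr => j _.
  have := expectation_ginibre_radial_product (bphi k j); rewrite unlock => pE.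
  transitivity (\int[G]_z (\prod_(i < N) phi k j i (normc (tnth z i)))%:E).
    apply: eq_integral => z _; congr EFin.
    rewrite (prodE (fun i h => h (normc (tnth z i))))//.
    by case: eqP => // ->.
  rewrite pE; congr (_ * _)%:E; apply: eq_bigr => s _.
  rewrite (prodE (fun i h => radius_mean (s i) h)) => [|i]; last exact: radius_mean1.
  by rewrite /a (inj_eq perm_inj).
under eq_bigr do rewrite sumEFin -mulr_sumr.
rewrite sumEFin -mulr_sumr; congr EFin.
under eq_bigr do rewrite exchange_big/=.
rewrite exchange_big/= (eq_bigr (fun=> \sum_(l < N) \sum_(m < N) a l m)%R); last first.
  move=> s _; rewrite [RHS](reindex_inj (@perm_inj _ s)); apply: eq_bigr => k _.
  by rewrite [RHS](reindex_inj (@perm_inj _ s)).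
by rewrite sumr_const card_Sn -[X in (_ * X)%R]mulr_natl mulKf.
Qed.

(** The off-diagonal terms of the second moment cancel against the product of the
    means. *)
Lemma cov_moduli_bounded_nonneg f g : bounded_nonneg f -> bounded_nonneg g ->
  cov G (moduli_statistic f) (moduli_statistic g) =
  \sum_(1 <= l < N.+1) cov P (f \o radius l) (g \o radius l).
Proof.
move=> bf bg; rewrite /cov expectation_ginibre_moduliM// !expectation_ginibre_moduli//.
rewrite big_add1/= big_mkord.
rewrite (eq_bigr (fun l : 'I_N => (radius_mean l (fun x => f x * g x)%R -
    radius_mean l f * radius_mean l g)%:E)); last first.
  move=> l _; have bfg := bounded_nonnegM bf bg.
  have Ef : 'E_P[f \o radius l.+1] = (radius_mean l f)%:E by exact: radius_meanE.
  have Eg : 'E_P[g \o radius l.+1] = (radius_mean l g)%:E by exact: radius_meanE.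
  have Efg : 'E_P[fun w => (f \o radius l.+1) w * (g \o radius l.+1) w]%R =
      (radius_mean l (fun x => f x * g x)%R)%:E by exact: (radius_meanE l bfg).
  by rewrite Ef Eg Efg -EFinM -EFinB.
rewrite sumEFin -EFinD big_distrlr/= -!sumrB; congr EFin.
apply: eq_bigr => l _; rewrite -sumrB (bigD1 l)//= eqxx big1 ?addr0//.
by move=> m /negbTE; rewrite eq_sym => ->; rewrite subrr.
Qed.

End kostlan.

Section cov_shift.
Local Open Scope ereal_scope.
Context d (T : measurableType d) (R : realType) (P : probability T R).

Lemma bounded_integrable (X : T -> R) (C : R) : measurable_fun setT X ->
  (forall w, `|X w| <= C)%R -> P.-integrable setT (EFin \o X).
Proof.
move=> mX XC; apply: measurable_bounded_integrable => //.
  by rewrite /= probability_setT ltry.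
exists C; split; first exact: num_real.
by move=> x Cx w _ /=; rewrite (le_trans (XC w))// ltW.
Qed.

(** This is bilinearity of the covariance and its vanishing on constants, for the
    formula [E (X Y) - E X E Y]. *)
Lemma cov_shift (X Y : T -> R) (a b : R) :
  P.-integrable setT (EFin \o X) -> P.-integrable setT (EFin \o Y) ->
  P.-integrable setT (EFin \o (fun w => X w * Y w)%R) ->
  cov P (fun w => X w + a)%R (fun w => Y w + b)%R = cov P X Y.
Proof.
move=> iX iY iXY.
have ic c : P.-integrable setT (EFin \o cst c) by exact: (@bounded_integrable _ `|c|%R).
have Ec c : \int[P]_w c%:E = c%:E by rewrite integral_cst//= probability_setT mule1.
have fin (Z : T -> R) : P.-integrable setT (EFin \o Z) ->
    'E_P[Z] = (fine 'E_P[Z])%:E.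
  by move=> iZ; rewrite unlock fineK//; exact: integrable_fin_num.
have shift (Z : T -> R) c : P.-integrable setT (EFin \o Z) ->
    'E_P[fun w => Z w + c]%R = (fine 'E_P[Z] + c)%:E.
  move=> iZ; rewrite EFinD -fin// unlock integralD_EFin//; last exact: ic.
  by rewrite Ec.
have XbYa : 'E_P[fun w => (X w + a) * (Y w + b)]%R =
    (fine 'E_P[fun w => X w * Y w]%R + a * fine 'E_P[Y] +
      b * fine 'E_P[X] + a * b)%:E.
  rewrite !EFinD !EFinM -!fin//.
  rewrite (_ : (fun w => _)%R =
      (fun w => (((X w * Y w) + a * Y w) + b * X w) + a * b)%R); last first.
    by apply/funext => w; ring.
  have iaY : P.-integrable setT (EFin \o (fun w => a * Y w)%R).
    exact: (integrableZl measurableT a iY).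
  have ibX : P.-integrable setT (EFin \o (fun w => b * X w)%R).
    exact: (integrableZl measurableT b iX).
  have i1 : P.-integrable setT (EFin \o (fun w => X w * Y w + a * Y w)%R).
    exact: (integrableD measurableT iXY iaY).
  have i2 : P.-integrable setT (EFin \o (fun w => X w * Y w + a * Y w + b * X w)%R).
    exact: (integrableD measurableT i1 ibX).
  rewrite unlock.
  have -> : \int[P]_w (X w * Y w + a * Y w + b * X w + a * b)%:E =
      \int[P]_w (X w * Y w + a * Y w + b * X w)%:E + \int[P]_w (a * b)%:E.
    exact: (integralD_EFin measurableT i2 (ic (a * b)%R)).
  have -> : \int[P]_w (X w * Y w + a * Y w + b * X w)%:E =
      \int[P]_w (X w * Y w + a * Y w)%:E + \int[P]_w (b * X w)%:E.
    exact: (integralD_EFin measurableT i1 ibX).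
  have -> : \int[P]_w (X w * Y w + a * Y w)%:E =
      \int[P]_w (X w * Y w)%:E + \int[P]_w (a * Y w)%:E.
    exact: (integralD_EFin measurableT iXY iaY).
  have -> : \int[P]_w (a * Y w)%:E = a%:E * \int[P]_w (Y w)%:E.
    exact: (integralZl measurableT iY a).
  have -> : \int[P]_w (b * X w)%:E = b%:E * \int[P]_w (X w)%:E.
    exact: (integralZl measurableT iX b).
  by rewrite Ec.
rewrite /cov/= XbYa !shift//.
move: (fin _ iX) (fin _ iY) (fin _ iXY).
set x := fine _; set y := fine _; set xy := fine _ => -> -> ->.
by rewrite -!EFinM -!EFinB; congr EFin; ring.
Qed.

End cov_shift.

(** * Reduction of bounded functions to non-negative ones *)

Section reduction.
Context (R : realType).

(** The absolute value extends [f] measurably to the whole line without changing it where the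
    moduli and radii take their values. *)
Lemma bounded_half_line_shift (f : R -> R) :
  measurable_fun (`[0, +oo[ : set R) f -> [bounded f x | x in (`[0, +oo[ : set R)] ->
  exists C, bounded_nonneg (fun x => f `|x| + C).
Proof.
move=> mf [M [_ /(_ (M + 1))]]; rewrite ltrDl ltr01 => /(_ isT) fM.
exists (M + 1); split; last first.
  exists (M + 1 + (M + 1)) => x; have := fM `|x|; rewrite /= in_itv/= normr_ge0.
  by move=> /(_ isT); rewrite ler_norml => /andP[? ?]; rewrite -lerBlDr sub0r lerD2r; apply/andP.
apply: measurable_funD => //.
apply: (measurable_comp (F := `[0, +oo[%classic : set R)) => //.
by move=> _ [x _ <-]; rewrite /= in_itv/= normr_ge0.
Qed.

Lemma integrable_bounded_nonneg d (T : measurableType d) (P : probability T R)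
    (f g : R -> R) (X Y : T -> R) : bounded_nonneg f -> bounded_nonneg g ->
  measurable_fun setT X -> measurable_fun setT Y ->
  P.-integrable setT (EFin \o (fun w => f (X w) * g (Y w))).
Proof.
move=> [mf [C hC]] [mg [D hD]] mX mY.
apply: (@bounded_integrable _ _ _ _ _ (C * D)) => [|w].
  by apply: measurable_funM; [exact: (measurableT_comp mf)|exact: (measurableT_comp mg)].
have /andP[f0 fC] := hC (X w); have /andP[g0 gD] := hD (Y w).
by rewrite ger0_norm ?mulr_ge0// ler_pM.
Qed.

Lemma moduli_statistic_bounds (N : nat) (f : R -> R) : bounded_nonneg f ->
  measurable_fun setT (@moduli_statistic R N f) /\
  exists C, forall z, 0 <= @moduli_statistic R N f z <= C.
Proof.
move=> [mf [C hC]]; split.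
  apply: measurable_sum => k; apply: (measurableT_comp mf).
  exact: (measurableT_comp (@measurable_normc R) (measurable_tnth k)).
exists (N%:R * C) => z; apply/andP; split.
  by apply: sumr_ge0 => k _; case/andP: (hC (normc (tnth z k))).
rewrite mulr_natl -[N in C *+ N]card_ord -sumr_const; apply: ler_sum => k _.
by case/andP: (hC (normc (tnth z k))).
Qed.

End reduction.

Theorem theorem1p1 (R : realType) (N : nat) (hN : (0 < N)%N) (f g : R -> R)
    (mf : measurable_fun (`[0, +oo[ : set R) f)
    (mg : measurable_fun (`[0, +oo[ : set R) g)
    (bf : [bounded f x | x in (`[0, +oo[ : set R)])
    (bg : [bounded g x | x in (`[0, +oo[ : set R)])
    (d : measure_display) (Omega : measurableType d) (P : probability Omega R)
    (eta : nat -> {RV P >-> R})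
    (eta_law : forall k, has_law P (eta k) (exponential_prob 1))
    (eta_indep : mutually_independent P (fun k => eta k : Omega -> R)) :
  let r := fun (l : nat) (w : Omega) =>
    Num.sqrt (N%:R^-1 * partial_sum (fun k => eta k : Omega -> R) l w) in
  (cov (ginibre R N) (moduli_statistic f) (moduli_statistic g) =
   \sum_(1 <= l < N.+1)
     ('E_P[fun w => (f (r l w) * g (r l w))%R]
      - 'E_P[fun w => f (r l w)] * 'E_P[fun w => g (r l w)]))%E.
Proof.
move=> r.
have [C bf'] := bounded_half_line_shift mf bf.
have [D bg'] := bounded_half_line_shift mg bg.
set f' := (fun x => _) in bf'; set g' := (fun x => _) in bg'.
(* adding [K] to the function adds [N K] to the statistic *)
have modE (h : R -> R) (K : R) : moduli_statistic h =
    (fun z : N.-tuple R[i] => moduli_statistic (fun x => h `|x| + K) z + - (N%:R * K)).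
  apply/funext => z; rewrite /moduli_statistic big_split/= sumr_const card_ord.
  rewrite -[K *+ N]mulr_natl addrK; apply: eq_bigr => k _.
  by rewrite ger0_norm// normc_ge0.
have mr l : measurable_fun setT (r l) by exact: measurable_radius.
have b1 := @bounded_nonneg1 R.
rewrite (modE f C) (modE g D) cov_shift.
- rewrite (cov_moduli_bounded_nonneg hN eta_law eta_indep bf' bg').
  apply: eq_bigr => l _.
  rewrite -(@cov_shift _ _ _ P _ _ (- C) (- D)).
  + by congr (_ - _ * _)%E; congr ('E_P[_])%E; apply/funext => w /=;
      rewrite /f' /g' /radius !addrK !ger0_norm ?sqrtr_ge0.
  + have := integrable_bounded_nonneg P bf' b1 (mr l) (mr l).
    by under eq_fun do rewrite mulr1.
  + have := integrable_bounded_nonneg P b1 bg' (mr l) (mr l).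
    by under eq_fun do rewrite mul1r.
  + exact: (integrable_bounded_nonneg P bf' bg' (mr l) (mr l)).
- have [mF [K hK]] := moduli_statistic_bounds N bf'.
  apply: (@bounded_integrable _ _ _ _ _ K) => // z.
  by have /andP[? ?] := hK z; rewrite ger0_norm.
- have [mG [K hK]] := moduli_statistic_bounds N bg'.
  apply: (@bounded_integrable _ _ _ _ _ K) => // z.
  by have /andP[? ?] := hK z; rewrite ger0_norm.
- have [mF [K hK]] := moduli_statistic_bounds N bf'.
  have [mG [L hL]] := moduli_statistic_bounds N bg'.
  apply: (@bounded_integrable _ _ _ _ _ (K * L)) => [|z]; first exact: measurable_funM.
  have /andP[? ?] := hK z; have /andP[? ?] := hL z.
  by rewrite ger0_norm ?mulr_ge0// ler_pM.
Qed.
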